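(* Let $f\in\mathcal{A}$, let $\alpha\geq 0$ and $\beta>0$ be real numbers, and put $\mu=\frac{\beta}{\alpha+\beta}$. If $$\left|\frac{zf'(z)}{f(z)}\right|^{\alpha}\left|z\left(\frac{zf'(z)}{f(z)}\right)'\right|^{\beta}<\left(\frac{1}{2}\mu\right)^{\beta}\qquad\text{for all } z\in\mathbb{U},$$ then $f\in\mathcal{STS}(\mu)$, i.e. $\mathrm{Re}\left(\left(\frac{zf'(z)}{f(z)}\right)^{1/\mu}\right)>0$ for all $z\in\mathbb{U}$.
   Context: $\mathbb{U}=\{z\in\mathbb{C}:|z|<1\}$ is the open unit disk. $\mathcal{A}$ is the class of functions $f$ analytic in $\mathbb{U}$ with $f(0)=0$ and $f'(0)=1$. The function $\frac{zf'(z)}{f(z)}$ has a removable singularity at $z=0$, where it takes the value $1$. For $0<\mu\leq 1$, $\mathcal{STS}(\mu)=\left\{f\in\mathcal{A}:\mathrm{Re}\left(\left(\frac{zf'(z)}{f(z)}\right)^{1/\mu}\right)>0 \text{ for all } z\in\mathbb{U}\right\}$, the complex power being taken with its principal value. The prime in $\left(\frac{zf'(z)}{f(z)}\right)'$ denotes differentiation with respect to $z$. *)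

(* Defs.v *)
(* Stdlib's real numbers with Coquelicot's complex numbers. *)
From Stdlib Require Import Reals.
From Coquelicot Require Import Coquelicot.
Open Scope R_scope.

Definition unit_disk (z : C) : Prop := Cmod z < 1.

(* Analyticity is local representability by a convergent power series. *)
Definition analytic_at (f : C -> C) (z0 : C) : Prop :=
  exists (a : nat -> C) (r : posreal), forall z : C,
    Cmod (z - z0)%C < r ->
    @is_pseries C_AbsRing C_NormedModule a (z - z0)%C (f z).

Definition analytic_on (D : C -> Prop) (f : C -> C) : Prop :=
  forall z : C, D z -> analytic_at f z.

(* Only the values of f on the unit disk matter: the disk is open, so
   C_derive f z depends only on them when z lies in the disk. *)
Definition class_A (f : C -> C) : Prop :=
  analytic_on unit_disk f /\ f (RtoC 0) = RtoC 0 /\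
  C_derive f (RtoC 0) = RtoC 1.

(* z f'(z) / f(z), extended by its limit 1 at the removable singularity 0. *)
Definition zf'_over_f (f : C -> C) (z : C) : C :=
  if Ceq_dec z (RtoC 0) then RtoC 1 else (z * C_derive f z / f z)%C.

(* x ^ y for x >= 0 and y >= 0.  Rpower x y is exp (y * ln x) with ln 0 = 0,
   hence would give 0 ^ y = 1; here 0 ^ y = 0 for y > 0, and 0 ^ 0 = 1. *)
Definition rpow (x y : R) : R :=
  if Req_EM_T x 0 then (if Req_EM_T y 0 then 1 else 0) else Rpower x y.

Definition Cexp (z : C) : C :=
  (exp (Re z) * cos (Im z), exp (Re z) * sin (Im z)).

(* The argument in (-PI, PI], for w <> 0. *)
Definition Carg (w : C) : R :=
  if Rle_dec 0 (Im w) then acos (Re w / Cmod w) else - acos (Re w / Cmod w).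

Definition Clog (w : C) : C := (ln (Cmod w), Carg w).

(* Principal value of w ^ c, with 0 ^ 0 = 1 and 0 ^ c = 0 otherwise. *)
Definition Cpower (w c : C) : C :=
  if Ceq_dec w (RtoC 0) then (if Ceq_dec c (RtoC 0) then RtoC 1 else RtoC 0)
  else Cexp (c * Clog w)%C.

(* Intended for 0 < mu <= 1. *)
Definition STS (mu : R) (f : C -> C) : Prop :=
  class_A f /\
  forall z : C, unit_disk z ->
    0 < Re (Cpower (zf'_over_f f z) (RtoC (1 / mu))).

(* Main.v *)
Require Import Defs.
From Stdlib Require Import Reals.
From Coquelicot Require Import Coquelicot.
From Stdlib Require Import Lra Psatz Classical IndefiniteDescription.
Open Scope R_scope.

(* Write p = z f' / f and q = p^(1/mu).  Since
   |z q'| = (1/mu) |p|^(alpha/beta) |z p'|, the hypothesis says |z q'| < 1/2.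
   On a disk |z| < r on which f(z)/z has no zero and p stays in the sector
   |arg p| < mu PI / 2, the maximum principle applied to q' gives
   |q'| <= 1/(2r), hence |q - 1| <= 1/2.  At a point z0 of least modulus where
   one of the two conditions fails, this bound passes to the limit along the
   segment [0, z0]: p stays bounded there, so that f(z0) <> 0 by a Gronwall
   argument, and q stays in |q - 1| <= 1/2, which keeps p strictly inside the
   sector.  So there is no such z0, and Re q > 0 on the whole disk. *)

(** The obstacle is that [q] is a principal power of a quotient. It is known to be holomorphic only
    where [f(z)/z] has no zero and [p] avoids the branch cut, and at a zero of [f] the quotient is a
    default value, so the hypothesis says nothing useful there. Hence the bound on [q] cannot be
    stated on the whole disk at once and is carried outward in |z|. This works because |q - 1| <=
    1/2 is strictly stronger than Re q > 0 and leaves room in the limit. The detour through the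
    maximum principle is forced by the origin: 1/(2|z|) is not integrable along a radius, whereas a
    constant bound on q' over a disk of radius r costs only a factor r. Apart from dividing f by z
    at 0, analyticity enters only as repeated complex differentiability, obtained termwise from the
    power series. The maximum principle then rests on second-order Taylor polynomials, without
    contour integrals. *)

Notation CK := (AbsRing_UniformSpace C_AbsRing).
Notation near z P := (@locally CK z P).
Notation cont f z := (@continuous CK CK f z).

(** The uniform structure is the one given by modulus balls, for which the product and chain rules
    are available; [cderiv_unique] links it to [C_derive]. *)
Definition cderiv (f : C -> C) (z l : C) : Prop :=
  @is_derive C_AbsRing (AbsRing_NormedModule C_AbsRing) f z l.

(** * Complex limits and derivatives in terms of the modulus *)

Lemma near_iff (z : C) (P : C -> Prop) :
  near z P <-> exists d, 0 < d /\ forall w : C, Cmod (w - z)%C < d -> P w.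
Proof.
  split.
  - intros [d Hd]. exists d. split; [apply cond_pos|]. exact Hd.
  - intros [d [Hd H]]. exists (mkposreal d Hd). exact H.
Qed.

Lemma cont_iff (f : C -> C) (z : C) :
  cont f z <->
  forall e, 0 < e -> near z (fun w => Cmod (f w - f z)%C < e).
Proof.
  split.
  - intros H e He.
    apply (H (fun y => Cmod (y - f z)%C < e)).
    exists (mkposreal e He). intros y Hy. exact Hy.
  - intros H P [e He].
    unfold filtermap. generalize (H e (cond_pos e)). apply filter_imp.
    intros w Hw. apply He. exact Hw.
Qed.

Lemma cderiv_iff (f : C -> C) (z l : C) :
  cderiv f z l <->
  forall e, 0 < e ->
    near z (fun w => Cmod (f w - f z - l * (w - z))%C <= e * Cmod (w - z)%C).
Proof.
  split.
  - intros [_ H] e He.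
    generalize (H z (fun P HP => HP) (mkposreal e He)). apply filter_imp.
    intros w Hw. rewrite (Cmult_comm l). exact Hw.
  - intros H. split.
    + apply is_linear_scal_l.
    + intros x Hx e.
      rewrite <- (is_filter_lim_locally_unique _ _ Hx).
      generalize (H e (cond_pos e)). apply filter_imp.
      intros w Hw. rewrite (Cmult_comm l) in Hw. exact Hw.
Qed.

Lemma cderiv_unique (f : C -> C) (z l : C) : cderiv f z l -> C_derive f z = l.
Proof.
  intros [_ H]. apply is_C_derive_unique. split; [apply is_linear_scal_l|exact H].
Qed.

Lemma cderiv_cont (f : C -> C) (z l : C) : cderiv f z l -> cont f z.
Proof.
  intros H. apply (ex_derive_continuous (V := AbsRing_NormedModule C_AbsRing)).
  exists l. exact H.
Qed.

Lemma cderiv_const (k z : C) : cderiv (fun _ => k) z 0%C.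
Proof. exact (is_derive_const (V := AbsRing_NormedModule C_AbsRing) k z). Qed.

Lemma cderiv_id (z : C) : cderiv (fun w => w) z 1%C.
Proof. exact (is_derive_id (K := C_AbsRing) z). Qed.

Lemma cderiv_plus (f g : C -> C) (z df dg : C) :
  cderiv f z df -> cderiv g z dg ->
  cderiv (fun w => f w + g w)%C z (df + dg)%C.
Proof.
  exact (is_derive_plus (V := AbsRing_NormedModule C_AbsRing) f g z df dg).
Qed.

Lemma cderiv_mult (f g : C -> C) (z df dg : C) :
  cderiv f z df -> cderiv g z dg ->
  cderiv (fun w => f w * g w)%C z (df * g z + f z * dg)%C.
Proof.
  intros Hf Hg.
  exact (is_derive_mult (K := C_AbsRing) f g z df dg Hf Hg Cmult_comm).
Qed.

Lemma cderiv_comp (f g : C -> C) (z df dg : C) :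
  cderiv f (g z) df -> cderiv g z dg ->
  cderiv (fun w => f (g w)) z (df * dg)%C.
Proof.
  intros Hf Hg. rewrite Cmult_comm.
  exact (is_derive_comp (V := AbsRing_NormedModule C_AbsRing) f g z df dg Hf Hg).
Qed.

Lemma cderiv_ext (f g : C -> C) (z l : C) :
  near z (fun w => f w = g w) -> cderiv f z l -> cderiv g z l.
Proof.
  exact (is_derive_ext_loc (V := AbsRing_NormedModule C_AbsRing) f g z l).
Qed.

Lemma cont_neq0 (f : C -> C) (z : C) :
  cont f z -> f z <> 0%C -> near z (fun w => f w <> 0%C).
Proof.
  intros H H0. apply Cmod_gt_0 in H0.
  apply cont_iff with (e := Cmod (f z)) in H; [|exact H0].
  revert H. apply filter_imp. intros w Hw E. rewrite E in Hw.
  replace (0 - f z)%C with (- f z)%C in Hw by ring.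
  rewrite Cmod_opp in Hw. lra.
Qed.

Lemma cont_Cinv (z : C) : z <> 0%C -> cont Cinv z.
Proof.
  intros Hz. apply cont_iff. intros e He.
  assert (H0 := proj1 (Cmod_gt_0 z) Hz).
  apply near_iff.
  exists (Rmin (Cmod z / 2) (e * (Cmod z * Cmod z) / 2)). split.
  { apply Rmin_glb_lt; [lra|]. apply Rdiv_lt_0_compat; [|lra].
    apply Rmult_lt_0_compat; [lra|nra]. }
  intros w Hw.
  assert (H1 : Cmod (w - z)%C < Cmod z / 2) by (eapply Rlt_le_trans; [exact Hw|apply Rmin_l]).
  assert (H2 : Cmod (w - z)%C < e * (Cmod z * Cmod z) / 2)
    by (eapply Rlt_le_trans; [exact Hw|apply Rmin_r]).
  assert (H3 : Cmod z <= Cmod w + Cmod (w - z)%C).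
  { replace z with (w + - (w - z))%C at 1 by ring.
    eapply Rle_trans; [apply Cmod_triangle|]. rewrite Cmod_opp. lra. }
  assert (Hw0 : w <> 0%C).
  { apply Cmod_gt_0. lra. }
  replace (/ w - / z)%C with (- ((w - z) / (w * z)))%C by (field; auto).
  rewrite Cmod_opp, Cmod_div, Cmod_mult by (apply Cmult_neq_0; auto).
  assert (H4 : 0 < Cmod w * Cmod z) by nra.
  apply (Rmult_lt_reg_r (Cmod w * Cmod z)); [exact H4|].
  unfold Rdiv. rewrite Rmult_assoc, Rinv_l, Rmult_1_r by lra.
  assert (Cmod z * Cmod z / 2 <= Cmod w * Cmod z) by nra.
  nra.
Qed.

Lemma cderiv_Cinv (z : C) : z <> 0%C -> cderiv Cinv z (- / (z * z))%C.
Proof.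
  intros Hz. apply cderiv_iff. intros e He.
  assert (H0 := proj1 (Cmod_gt_0 z) Hz).
  assert (He' : 0 < e * Cmod z) by nra.
  generalize (proj1 (cont_iff _ _) (cont_Cinv z Hz) _ He')
    (cont_neq0 (fun w => w) z (continuous_id _) Hz).
  intros A B. generalize (filter_and _ _ A B). apply filter_imp.
  intros w [Hw Hw0].
  (* The remainder is (w - z) times a multiple of 1/w - 1/z, so continuity of the inverse is
     enough. *)
  replace (/ w - / z - - / (z * z) * (w - z))%C
    with (- ((/ w - / z) * (w - z) * / z))%C by (field; auto).
  rewrite Cmod_opp, !Cmod_mult, Cmod_inv by auto.
  assert (Hd := Cmod_ge_0 (w - z)%C).
  apply (Rmult_le_reg_r (Cmod z)); [exact H0|].
  rewrite !Rmult_assoc, Rinv_l by lra. nra.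
Qed.

Lemma near_shift (z : C) (P : C -> Prop) :
  near z P -> near (RtoC 0) (fun h => P (z + h)%C).
Proof.
  intros H. apply near_iff in H. destruct H as [d [Hd H]]. apply near_iff.
  exists d. split; [exact Hd|]. intros h Hh. apply H.
  replace (z + h - z)%C with (h - 0)%C by ring. exact Hh.
Qed.

(** * Repeated complex differentiability *)

(** The derivative is existentially quantified so that closure proofs can supply an explicit
    formula, valid near [z]; [smooth_derive] returns to [C_derive]. *)
Fixpoint smooth (n : nat) (f : C -> C) (z : C) : Prop :=
  match n with
  | O => True
  | S m => exists f', near z (fun w => cderiv f w (f' w)) /\ smooth m f' z
  end.

Lemma smooth_ext (n : nat) (f g : C -> C) (z : C) :
  near z (fun w => f w = g w) -> smooth n f z -> smooth n g z.
Proof.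
  destruct n as [|n]; [easy|]. intros E [f' [Hf' H]]. exists f'. split; [|exact H].
  apply locally_locally in E. generalize (filter_and _ _ E Hf').
  apply filter_imp. intros w [A B]. apply cderiv_ext with f; assumption.
Qed.

Lemma smooth_pred (n : nat) (f : C -> C) (z : C) : smooth (S n) f z -> smooth n f z.
Proof.
  revert f. induction n as [|n IH]; [easy|]. intros f [f' [Hf' H]].
  exists f'. split; [exact Hf'|]. apply IH. exact H.
Qed.

Lemma smooth_cderiv (n : nat) (f : C -> C) (z : C) :
  smooth (S n) f z -> cderiv f z (C_derive f z).
Proof.
  intros [f' [H _]]. apply locally_singleton in H.
  rewrite (cderiv_unique _ _ _ H). exact H.
Qed.

Lemma smooth_derive (n : nat) (f : C -> C) (z : C) :
  smooth (S n) f z -> smooth n (C_derive f) z.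
Proof.
  intros [f' [H H']]. apply smooth_ext with f'; [|exact H'].
  revert H. apply filter_imp. intros w Hw. symmetry. apply cderiv_unique. exact Hw.
Qed.

Lemma smooth_near (n : nat) (f : C -> C) (z : C) :
  smooth (S n) f z -> near z (fun w => cderiv f w (C_derive f w)).
Proof.
  intros [f' [H _]]. revert H. apply filter_imp. intros w Hw.
  rewrite (cderiv_unique _ _ _ Hw). exact Hw.
Qed.

Lemma smooth_cont (n : nat) (f : C -> C) (z : C) : smooth (S n) f z -> cont f z.
Proof. intros H. apply smooth_cderiv in H. apply cderiv_cont in H. exact H. Qed.

Lemma smooth_const (n : nat) (k z : C) : smooth n (fun _ => k) z.
Proof.
  revert k. induction n as [|n IH]; [easy|]. intros k. exists (fun _ => 0%C). split.
  - apply filter_forall. intros w. apply cderiv_const.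
  - apply IH.
Qed.

Lemma smooth_id (n : nat) (z : C) : smooth n (fun w => w) z.
Proof.
  destruct n as [|n]; [easy|]. exists (fun _ => 1%C). split.
  - apply filter_forall. intros w. apply cderiv_id.
  - apply smooth_const.
Qed.

Lemma smooth_plus (n : nat) (f g : C -> C) (z : C) :
  smooth n f z -> smooth n g z -> smooth n (fun w => f w + g w)%C z.
Proof.
  revert f g. induction n as [|n IH]; [easy|].
  intros f g [f' [Hf Hf']] [g' [Hg Hg']].
  exists (fun w => f' w + g' w)%C. split; [|apply IH; assumption].
  generalize (filter_and _ _ Hf Hg). apply filter_imp. intros w [A B].
  apply cderiv_plus; assumption.
Qed.

Lemma smooth_mult (n : nat) (f g : C -> C) (z : C) :
  smooth n f z -> smooth n g z -> smooth n (fun w => f w * g w)%C z.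
Proof.
  revert f g. induction n as [|n IH]; [easy|].
  intros f g Hf Hg.
  assert (Hf0 := smooth_pred _ _ _ Hf). assert (Hg0 := smooth_pred _ _ _ Hg).
  destruct Hf as [f' [Hf Hf']]. destruct Hg as [g' [Hg Hg']].
  exists (fun w => f' w * g w + f w * g' w)%C. split.
  - generalize (filter_and _ _ Hf Hg). apply filter_imp. intros w [A B].
    apply cderiv_mult; assumption.
  - apply smooth_plus; apply IH; assumption.
Qed.

(** The derivative of 1/f is written as a product of copies of 1/f and f', all covered by the
    induction hypothesis at the lower order. *)
Lemma smooth_inv (n : nat) (f : C -> C) (z : C) :
  f z <> 0%C -> smooth n f z -> smooth n (fun w => / f w)%C z.
Proof.
  intros H0. induction n as [|n IH]; [easy|]. intros Hf.
  assert (N := cont_neq0 _ _ (smooth_cont _ _ _ Hf) H0).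
  assert (IH' := IH (smooth_pred _ _ _ Hf)).
  destruct Hf as [f' [Hf Hf']].
  exists (fun w => (-(1)) * ((/ f w) * (/ f w)) * f' w)%C. split.
  - generalize (filter_and _ _ Hf N). apply filter_imp. intros w [A B].
    replace ((-(1)) * ((/ f w) * (/ f w)) * f' w)%C
      with (- / (f w * f w) * f' w)%C by (field; auto).
    apply (cderiv_comp Cinv f); [|exact A]. apply cderiv_Cinv. exact B.
  - repeat apply smooth_mult; try assumption. apply smooth_const.
Qed.

(** * Maxima of upper semicontinuous functions on compact sets *)

Lemma Cmod_le_2max (z : C) (d : R) : Rabs (Re z) < d -> Rabs (Im z) < d -> Cmod z < 2 * d.
Proof.
  intros H1 H2. replace z with (RtoC (Re z) + Ci * RtoC (Im z))%C.
  - eapply Rle_lt_trans; [apply Cmod_triangle|].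
    rewrite Cmod_mult, Cmod_Ci, !Cmod_R. lra.
  - destruct z as [x y]. unfold Ci, RtoC, Cplus, Cmult; simpl. f_equal; ring.
Qed.

(** Without a maximum, every point has a neighbourhood on which [u] stays, over K, strictly below
    its value at some witness in K. Finitely many such neighbourhoods cover the square of half-side
    [M], and the best of their witnesses would be strictly below another one. *)
Lemma compact_attains_max (K : C -> Prop) (u : C -> R) (M : R) :
  (forall z, K z -> Cmod z <= M) ->
  (forall z, ~ K z -> near z (fun w => ~ K w)) ->
  (exists z, K z) ->
  (forall z, K z -> forall e, 0 < e -> near z (fun w => K w -> u w < u z + e)) ->
  exists z, K z /\ forall w, K w -> u w <= u z.
Proof.
  intros Hb Hcl [k0 Hk0] Hu.
  apply NNPP. intros Hno.
  assert (Hloc : forall t : Compactness.Tn 2 R, exists p : posreal * C,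
    K (snd p) /\ forall w : C,
      Cmod (w - (fst t, fst (snd t)))%C < 2 * fst p -> K w -> u w < u (snd p)).
  { intros [x [y tt]]. simpl.
    assert (H : exists z', K z' /\ near (x, y) (fun w => K w -> u w < u z')).
    { destruct (classic (K (x, y))) as [HK|HK].
      - destruct (classic (exists z', K z' /\ u (x, y) < u z')) as [[z' [Hz' Hlt]]|H].
        + exists z'. split; [exact Hz'|].
          assert (He : 0 < u z' - u (x, y)) by lra.
          generalize (Hu _ HK _ He). apply filter_imp. intros w Hw Kw.
          specialize (Hw Kw). lra.
        + exfalso. apply Hno. exists (x, y). split; [exact HK|].
          intros w Hw. apply Rnot_lt_le. intros Hlt. apply H. exists w. easy.
      - exists k0. split; [exact Hk0|]. generalize (Hcl _ HK). apply filter_imp.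
        intros w H1 H2. easy. }
    destruct H as [z' [Hz' H]]. apply near_iff in H. destruct H as [d [Hd H]].
    (* The covering theorem measures closeness coordinatewise; halving the radius pays for the
       factor 2 in [Cmod_le_2max]. *)
    assert (Hd2 : 0 < d / 2) by lra.
    exists (mkposreal _ Hd2, z'). simpl. split; [exact Hz'|].
    intros w Hw. apply H. lra. }
  destruct (functional_choice _ Hloc) as [F HF].
  apply (compactness_list 2 (- M, (- M, tt)) (M, (M, tt)) (fun t => fst (F t))).
  intros [l Hl].
  assert (Hmax : exists z, K z /\ forall t, List.In t l -> u (snd (F t)) <= u z).
  { clear Hl. induction l as [|t l [z [Hz IH]]].
    - exists k0. easy.
    - destruct (Rle_dec (u (snd (F t))) (u z)) as [H|H].
      + exists z. split; [exact Hz|]. intros t' [<-|Ht']; auto.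
      + exists (snd (F t)). split; [apply HF|]. intros t' [<-|Ht'].
        * lra.
        * specialize (IH _ Ht'). lra. }
  destruct Hmax as [z [Hz Hmax]].
  destruct (Hl (fst z, (snd z, tt))) as [t [Ht [_ Hc]]].
  - assert (A := Rle_trans _ _ _ (Rmax_Cmod z) (Hb z Hz)).
    assert (A1 := Rle_trans _ _ _ (Rmax_l _ _) A).
    assert (A2 := Rle_trans _ _ _ (Rmax_r _ _) A).
    apply Rabs_le_between in A1. apply Rabs_le_between in A2.
    simpl. repeat split; lra.
  - specialize (Hmax t Ht). destruct (HF t) as [_ H].
    enough (u z < u (snd (F t))) by lra.
    apply H; [|exact Hz]. destruct t as [x [y tt]]. simpl in Hc |- *.
    apply Cmod_le_2max; destruct z as [zx zy]; simpl in *; easy.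
Qed.

(** * Mean value inequality and second-order Taylor expansion *)

Lemma re_mult_le (a b : C) : Rabs (Re (a * b)%C) <= Cmod a * Cmod b.
Proof. rewrite <- Cmod_mult. apply re_le_Cmod. Qed.

(** The multiplier [u] selects the real direction observed: the conjugate of an increment for the
    mean value inequality, [1] and [- Ci] for real and imaginary parts. *)
Lemma line_derive (f : C -> C) (u z h l : C) (t : R) :
  cderiv f (z + t * h)%C l ->
  is_derive (fun s : R => Re (u * f (z + s * h)%C)%C) t (Re (u * (l * h))%C).
Proof.
  intros H. apply is_derive_Reals. intros e He.
  assert (A := Cmod_ge_0 u). assert (B := Cmod_ge_0 h).
  assert (AB : 0 <= Cmod u * Cmod h) by nra.
  set (e' := e / (Cmod u * Cmod h + 1)).
  assert (He' : 0 < e') by (apply Rdiv_lt_0_compat; lra).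
  assert (Ee' : e' * (Cmod u * Cmod h) < e).
  { unfold e'. apply (Rmult_lt_reg_r (Cmod u * Cmod h + 1)); [lra|].
    replace (e / (Cmod u * Cmod h + 1) * (Cmod u * Cmod h) * (Cmod u * Cmod h + 1))
      with (e * (Cmod u * Cmod h)) by (field; lra). nra. }
  apply cderiv_iff with (e := e') in H; [|exact He'].
  apply near_iff in H. destruct H as [d [Hd H]].
  assert (Hd' : 0 < d / (Cmod h + 1)) by (apply Rdiv_lt_0_compat; lra).
  exists (mkposreal _ Hd'). intros s Hs0 Hs. simpl in Hs.
  assert (E : ((z + (t + s)%R * h) - (z + t * h))%C = (s * h)%C)
    by (rewrite RtoC_plus; ring).
  specialize (H (z + (t + s)%R * h)%C). rewrite E, Cmod_mult, Cmod_R in H.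
  assert (Hsd : Rabs s * Cmod h < d).
  { apply (Rmult_lt_compat_r (Cmod h + 1)) in Hs; [|lra].
    unfold Rdiv in Hs. rewrite Rmult_assoc, Rinv_l in Hs by lra.
    assert (C := Rabs_pos s). nra. }
  specialize (H Hsd).
  assert (Hs1 := Rabs_pos_lt s Hs0).
  replace ((Re (u * f (z + (t + s)%R * h)%C)%C - Re (u * f (z + t * h)%C)%C) / s
    - Re (u * (l * h))%C)
    with (Re (u * (f (z + (t + s)%R * h)%C - f (z + t * h)%C - l * (s * h)))%C / s)
    by (simpl; field; exact Hs0).
  unfold Rdiv. rewrite Rabs_mult, Rabs_inv.
  apply (Rmult_lt_reg_r (Rabs s)); [exact Hs1|].
  rewrite Rmult_assoc, Rinv_l, Rmult_1_r by lra.
  eapply Rle_lt_trans; [apply re_mult_le|].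
  eapply Rle_lt_trans; [apply Rmult_le_compat_l; [exact A|exact H]|]. nra.
Qed.

(** The increment D is projected on its own direction: the real mean value theorem applies to
    Re(conj(D) k), whose total change is |D|^2. *)
Lemma mean_value_Cmod (k dk : C -> C) (z h : C) (B : R) :
  (forall t : R, 0 <= t <= 1 ->
     cderiv k (z + t * h)%C (dk (z + t * h)%C) /\ Cmod (dk (z + t * h)%C) <= B) ->
  Cmod (k (z + h) - k z)%C <= B * Cmod h.
Proof.
  intros H.
  set (D := (k (z + h) - k z)%C).
  destruct (MVT_gen (fun t : R => Re (Cconj D * k (z + t * h)%C)%C) 0 1
    (fun t => Re (Cconj D * (dk (z + t * h)%C * h))%C)) as [t [Ht E]].
  - intros t Ht. rewrite Rmin_left, Rmax_right in Ht by lra.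
    apply line_derive. apply H. lra.
  - intros t Ht. rewrite Rmin_left, Rmax_right in Ht by lra.
    apply continuity_pt_filterlim.
    apply (ex_derive_continuous (V := R_NormedModule)).
    eexists. apply line_derive. apply H. lra.
  - rewrite Rmin_left, Rmax_right in Ht by lra.
    assert (E2 : Re (Cconj D * k (z + 1%R * h)%C) - Re (Cconj D * k (z + 0%R * h)%C)
      = Cmod D ^ 2).
    { rewrite Cmod2_alt. replace (z + 1%R * h)%C with (z + h)%C by ring.
      replace (z + 0%R * h)%C with z by ring. unfold D. simpl. ring. }
    rewrite E2 in E.
    assert (A := Cmod_ge_0 D). destruct (H t Ht) as [_ HB].
    assert (A2 := Cmod_ge_0 h). assert (A3 := Cmod_ge_0 (dk (z + t * h)%C)).
    assert (Hle := re_mult_le (Cconj D) (dk (z + t * h)%C * h)%C).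
    rewrite Cmod_conj, Cmod_mult in Hle.
    assert (Hle2 := Rle_trans _ _ _ (Rle_abs _) Hle).
    destruct (Req_dec (Cmod D) 0) as [->|N]; [nra|].
    apply (Rmult_le_reg_l (Cmod D)); [lra|].
    assert (Cmod (dk (z + t * h)%C) * Cmod h <= B * Cmod h) by (apply Rmult_le_compat_r; lra).
    nra.
Qed.

(** Subtracting the quadratic polynomial leaves a function whose derivative is o(|h|) on the
    segment, since g' is differentiable at [z]; the mean value inequality adds the second factor
    |h|. *)
Lemma taylor2 (g : C -> C) (z : C) :
  smooth 2 g z -> exists a b : C, forall e, 0 < e ->
    near (RtoC 0) (fun h =>
      Cmod (g (z + h) - g z - a * h - b * (h * h))%C <= e * (Cmod h * Cmod h)).
Proof.
  intros Hg. exists (C_derive g z), (C_derive (C_derive g) z / 2)%C. intros e He.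
  assert (H1 := smooth_near _ _ _ Hg).
  assert (H2 := smooth_cderiv _ _ _ (smooth_derive _ _ _ Hg)).
  apply cderiv_iff with (e := e) in H2; [|exact He].
  assert (H := filter_and _ _ H1 H2). apply near_iff in H. clear H1 H2.
  destruct H as [d [Hd H]]. apply near_iff. exists d. split; [exact Hd|].
  intros h Hh. replace (h - 0)%C with h in Hh by ring.
  set (a := C_derive g z) in *. set (b := C_derive (C_derive g) z) in *.
  set (k := fun w => (g w + (- a * w + (- (b / 2)) * ((w + - z) * (w + - z))))%C).
  replace (g (z + h) - g z - a * h - b / 2 * (h * h))%C with (k (z + h) - k z)%C
    by (unfold k; field; intros E; inversion E; lra).
  rewrite <- Rmult_assoc.
  apply mean_value_Cmod with
    (dk := fun w => (C_derive g w - a - b * (w - z))%C).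
  intros t Ht.
  assert (Hh0 := Cmod_ge_0 h).
  assert (E : Cmod (z + t * h - z)%C = t * Cmod h).
  { replace (z + t * h - z)%C with (t * h)%C by ring.
    rewrite Cmod_mult, Cmod_R, Rabs_pos_eq by lra. reflexivity. }
  destruct (H (z + t * h)%C) as [H1 H2]; [rewrite E; nra|].
  set (w := (z + t * h)%C) in *.
  split.
  - replace (C_derive g w - a - b * (w - z))%C with
      (C_derive g w + ((0 * w + - a * 1) + (0 * ((w + - z) * (w + - z)) +
        (- (b / 2)) * ((1 + 0) * (w + - z) + (w + - z) * (1 + 0)))))%C
      by (field; intros F; inversion F; lra).
    assert (L := cderiv_plus _ _ w _ _ (cderiv_id w) (cderiv_const (- z)%C w)).
    exact (cderiv_plus _ _ _ _ _ H1 (cderiv_plus _ _ _ _ _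
      (cderiv_mult _ _ _ _ _ (cderiv_const (- a)%C w) (cderiv_id w))
      (cderiv_mult _ _ _ _ _ (cderiv_const (- (b / 2))%C w)
        (cderiv_mult _ _ _ _ _ L L)))).
  - rewrite E in H2. eapply Rle_trans; [exact H2|].
    apply Rmult_le_compat_l; [lra|]. rewrite <- (Rmult_1_l (Cmod h)) at 2.
    apply Rmult_le_compat_r; lra.
Qed.

(** * The maximum modulus principle *)

Lemma Cmod_sqr_perturb (p r : C) (S e : R) :
  Cmod p <= S -> Cmod r <= e -> Cmod p ^ 2 - 2 * S * e <= Cmod (p + r)%C ^ 2.
Proof.
  intros Hp Hr. assert (A := Cmod_ge_0 p). assert (B := Cmod_ge_0 r).
  assert (D := Cmod_ge_0 (p + r)%C).
  assert (T : Cmod p <= Cmod (p + r)%C + Cmod r).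
  { replace p with ((p + r) + - r)%C at 1 by ring.
    eapply Rle_trans; [apply Cmod_triangle|]. rewrite Cmod_opp. lra. }
  assert (Cmod p * Cmod r <= S * e) by (apply Rmult_le_compat; lra).
  destruct (Rle_dec (Cmod p) (Cmod r)) as [L|L].
  - assert (Cmod p * Cmod p <= Cmod p * Cmod r) by (apply Rmult_le_compat_l; lra).
    assert (0 <= Cmod (p + r)%C ^ 2) by apply pow2_ge_0. nra.
  - assert ((Cmod p - Cmod r) ^ 2 <= Cmod (p + r)%C ^ 2) by (apply pow_incr; lra).
    nra.
Qed.

(** The cross terms are linear in h, in h^2, or in |h|^2 h. The pairs t, -t and it, -it cancel the
    odd ones, and h^2 changes sign from one pair to the other. *)
Lemma four_sum (c a b : C) (t : R) :
  let P h := (c + a * h + b * (h * h))%C in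
  Cmod (P (RtoC t)) ^ 2 + Cmod (P (RtoC (- t))) ^ 2 + Cmod (P (Ci * t)%C) ^ 2
    + Cmod (P (Ci * (- t)%R)%C) ^ 2
  = 4 * (Cmod c ^ 2 + Cmod a ^ 2 * t ^ 2 + Cmod b ^ 2 * t ^ 4).
Proof. intros P. unfold P. rewrite !Cmod2_alt. unfold Re, Im. simpl. ring. Qed.

(* Averaging over [h, ih, -h, -ih] kills all cross terms of the second-order
   Taylor polynomial, so [|g|^2] is subharmonic and the added [eps |w|^2] makes
   the average strictly larger than the central value. *)
Lemma no_interior_max (g : C -> C) (z : C) (eps : R) :
  smooth 2 g z -> 0 < eps ->
  ~ near z (fun w =>
      Cmod (g w) ^ 2 + eps * Cmod w ^ 2 <= Cmod (g z) ^ 2 + eps * Cmod z ^ 2).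
Proof.
  intros Hg Heps Hmax. destruct (taylor2 g z Hg) as [a [b H]].
  (* [S] bounds the Taylor polynomial for |h| <= 1. A remainder of size [e] t^2 then costs at most 2
     S e t^2 in the squared modulus, and [e] is chosen to keep this below the gain eps t^2. *)
  set (S := Cmod (g z) + Cmod a + Cmod b).
  assert (A1 := Cmod_ge_0 (g z)). assert (A2 := Cmod_ge_0 a). assert (A3 := Cmod_ge_0 b).
  assert (HS : 0 <= S) by (unfold S; lra).
  set (e := eps / (2 * S + 1) / 2).
  assert (He : 0 < e) by (unfold e; apply Rdiv_lt_0_compat; [apply Rdiv_lt_0_compat|]; lra).
  assert (HSe : 2 * S * e < eps).
  { assert (e * (2 * S + 1) = eps / 2) by (unfold e; field; lra). nra. }
  generalize (filter_and _ _ (H e He) (near_shift _ _ Hmax)). clear H Hmax. intros H.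
  apply near_iff in H. destruct H as [d [Hd H]].
  set (t := Rmin (d / 2) 1).
  assert (Ht0 : 0 < t) by (apply Rmin_glb_lt; lra).
  assert (Ht1 : t <= 1) by apply Rmin_r.
  assert (Htd : t < d) by (eapply Rle_lt_trans; [apply Rmin_l|lra]).
  set (P := fun h => (g z + a * h + b * (h * h))%C).
  assert (Hpt : forall h : C, Cmod h = t ->
    Cmod (P h) ^ 2 - 2 * S * (e * (t * t)) + eps * Cmod (z + h)%C ^ 2
      <= Cmod (g z) ^ 2 + eps * Cmod z ^ 2).
  { intros h Hh. destruct (H h) as [H1 H2].
    { replace (h - 0)%C with h by ring. lra. }
    rewrite Hh in H1.
    eapply Rle_trans; [|exact H2]. apply Rplus_le_compat_r.
    replace (g (z + h)%C) with (P h + (g (z + h) - g z - a * h - b * (h * h)))%C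
      by (unfold P; ring).
    apply Cmod_sqr_perturb; [|exact H1].
    unfold P, S. eapply Rle_trans; [apply Cmod_triangle|].
    eapply Rle_trans; [apply Rplus_le_compat_r; apply Cmod_triangle|].
    rewrite !Cmod_mult, Hh.
    assert (Cmod a * t <= Cmod a) by nra.
    assert (Cmod b * (t * t) <= Cmod b) by (assert (t * t <= 1) by nra; nra). lra. }
  assert (N : forall s : R, Rabs s = t -> Cmod (Ci * s)%C = t).
  { intros s Hs. rewrite Cmod_mult, Cmod_Ci, Cmod_R. lra. }
  assert (T1 : Rabs t = t) by (apply Rabs_pos_eq; lra).
  assert (T2 : Rabs (- t) = t) by (rewrite Rabs_Ropp; exact T1).
  assert (Q1 := Hpt (RtoC t) (eq_trans (Cmod_R t) T1)).
  assert (Q2 := Hpt (RtoC (- t)) (eq_trans (Cmod_R _) T2)).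
  assert (Q3 := Hpt _ (N t T1)). assert (Q4 := Hpt _ (N _ T2)).
  assert (F1 := four_sum (g z) a b t). change (fun h => _) with P in F1.
  cbv zeta in F1.
  (* The same identity for the polynomial z + h: the average of |z + h|^2 exceeds |z|^2 by exactly
     t^2. *)
  assert (F2 := four_sum z 1 0 t). cbv beta zeta in F2.
  assert (R0 : forall h : C, (z + 1 * h + 0 * (h * h) = z + h)%C) by (intros; ring).
  rewrite !R0, Cmod_1, Cmod_0 in F2.
  assert (0 <= Cmod a ^ 2 * t ^ 2) by (apply Rmult_le_pos; apply pow2_ge_0).
  assert (0 <= Cmod b ^ 2 * t ^ 4)
    by (apply Rmult_le_pos; [apply pow2_ge_0|apply pow_le; lra]).
  assert (H2 : 0 < t * t) by nra.
  assert (H3 := Rmult_lt_compat_r _ _ _ H2 HSe).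
  nra.
Qed.

Lemma Cmod_usc_near (g : C -> C) (z : C) (e : R) :
  cont g z -> 0 < e -> near z (fun w => Cmod (g w) < Cmod (g z) + e).
Proof.
  intros H He. apply cont_iff with (e := e) in H; [|exact He]. revert H.
  apply filter_imp. intros w Hw.
  replace (g w) with (g z + (g w - g z))%C by ring.
  eapply Rle_lt_trans; [apply Cmod_triangle|]. lra.
Qed.

(** If |g(z1)| > M, take eps r^2 to be half of |g(z1)|^2 - M^2. On the circle, |g|^2 + eps |w|^2
    then stays below its value at z1, so its maximum over the disk is interior, which
    [no_interior_max] forbids. *)
Lemma max_modulus (g : C -> C) (r M : R) :
  0 < r -> (forall z, Cmod z <= r -> smooth 2 g z) ->
  (forall z, Cmod z = r -> Cmod (g z) <= M) ->
  forall z, Cmod z <= r -> Cmod (g z) <= M.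
Proof.
  intros Hr Hg HM z1 Hz1. apply Rnot_lt_le. intros Hlt.
  assert (HM0 : 0 <= M).
  { apply Rle_trans with (Cmod (g (RtoC r))); [apply Cmod_ge_0|].
    apply HM. rewrite Cmod_R, Rabs_pos_eq; lra. }
  set (eps := (Cmod (g z1) ^ 2 - M ^ 2) / (2 * r ^ 2)).
  assert (Hr2 : 0 < r ^ 2) by (apply pow_lt; exact Hr).
  assert (Heps : 0 < eps) by (apply Rdiv_lt_0_compat; nra).
  assert (Heps2 : eps * r ^ 2 = (Cmod (g z1) ^ 2 - M ^ 2) / 2) by (unfold eps; field; lra).
  set (u := fun w => Cmod (g w) ^ 2 + eps * Cmod w ^ 2).
  destruct (compact_attains_max (fun z => Cmod z <= r) u r) as [z0 [Hz0 Hmax]].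
  - easy.
  - intros z Hz. apply near_iff. exists (Cmod z - r). split; [lra|].
    intros w Hw Hwr.
    assert (Cmod z <= Cmod w + Cmod (w - z)%C).
    { replace z with (w + - (w - z))%C at 1 by ring.
      eapply Rle_trans; [apply Cmod_triangle|]. rewrite Cmod_opp. lra. }
    lra.
  - exists z1. exact Hz1.
  - intros z Hz e He.
    assert (B1 := Cmod_ge_0 (g z)). assert (B2 := Cmod_ge_0 z).
    (* For d <= 1, raising a modulus m by at most d raises m^2 by at most d (2 m + 1); [Q] collects
       both contributions. *)
    set (Q := (2 * Cmod (g z) + 1) + eps * (2 * Cmod z + 1)).
    assert (HQ : 0 < Q) by (unfold Q; nra).
    set (d := Rmin 1 (e / (2 * Q))).
    assert (Hd : 0 < d) by (apply Rmin_glb_lt; [lra|apply Rdiv_lt_0_compat; lra]).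
    assert (Hd1 : d <= 1) by apply Rmin_l.
    assert (HdQ : d * Q <= e / 2).
    { replace (e / 2) with (e / (2 * Q) * Q) by (field; lra).
      apply Rmult_le_compat_r; [lra|apply Rmin_r]. }
    assert (Cg := smooth_cont _ _ _ (Hg z Hz)).
    generalize (filter_and _ _ (Cmod_usc_near g z d Cg Hd)
      (Cmod_usc_near (fun w => w) z d (continuous_id _) Hd)).
    apply filter_imp. intros w [W1 W2] _. unfold u.
    assert (B3 := Cmod_ge_0 (g w)). assert (B4 := Cmod_ge_0 w).
    assert (Cmod (g w) ^ 2 <= Cmod (g z) ^ 2 + d * (2 * Cmod (g z) + 1)) by nra.
    assert (Cmod w ^ 2 <= Cmod z ^ 2 + d * (2 * Cmod z + 1)) by nra.
    unfold Q in HdQ. nra.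
  - assert (H1 := Hmax z1 Hz1). unfold u in H1.
    assert (C1 : 0 <= Cmod z1 ^ 2) by apply pow2_ge_0.
    assert (C0 := Cmod_ge_0 z0).
    destruct (Req_dec (Cmod z0) r) as [E|N].
    + assert (H2 := HM z0 E). rewrite E in H1. assert (D := Cmod_ge_0 (g z0)). nra.
    + apply (no_interior_max g z0 eps (Hg z0 Hz0) Heps).
      apply near_iff. exists (r - Cmod z0). split; [lra|]. intros w Hw.
      apply (Hmax w). replace w with (z0 + (w - z0))%C by ring.
      eapply Rle_trans; [apply Cmod_triangle|]. lra.
Qed.

(** * Differentiation of power series *)

Notation cseries a l := (@is_series C_AbsRing C_NormedModule a l).
Notation cpseries a h l := (@is_pseries C_AbsRing C_NormedModule a h l).
Notation cpow h n := (@pow_n C_AbsRing h n).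
Notation csum a n := (@sum_n C_NormedModule a n).

Lemma cseries_near (a : nat -> C) (l : C) (e : R) :
  cseries a l -> 0 < e -> exists N, forall n, (N <= n)%nat -> Cmod (csum a n - l)%C < e.
Proof.
  intros H He. apply (H (fun y : C => Cmod (y - l)%C < e)).
  apply (proj2 (locally_C l _)). exists (mkposreal e He). intros y Hy. exact Hy.
Qed.

Lemma cseries_unique (a : nat -> C) (l l' : C) : cseries a l -> cseries a l' -> l = l'.
Proof.
  intros H H'. exact (filterlim_locally_unique (V := C_NormedModule) _ _ _ H H').
Qed.

Lemma csum_le (a : nat -> C) (b : nat -> R) (n : nat) :
  (forall k, Cmod (a k) <= b k) -> Cmod (csum a n) <= sum_n b n.
Proof.
  intros H. induction n as [|n IH].
  - rewrite !sum_O. apply H.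
  - rewrite !sum_Sn. eapply Rle_trans; [apply Cmod_triangle|].
    apply Rplus_le_compat; [exact IH|apply H].
Qed.

Lemma cseries_le (a : nat -> C) (b : nat -> R) (l : C) :
  (forall k, Cmod (a k) <= b k) -> ex_series b -> cseries a l -> Cmod l <= Series b.
Proof.
  intros H Hb Ha. apply le_epsilon. intros e He.
  destruct (cseries_near a l e Ha He) as [N HN]. specialize (HN N (le_n N)).
  assert (H1 := csum_le a b N H).
  assert (H2 : sum_n b N <= Series b).
  { apply (is_lim_seq_incr_compare (sum_n b) (Series b)).
    - apply Series_correct. exact Hb.
    - intros n. rewrite sum_Sn. assert (0 <= b (S n)).
      { eapply Rle_trans; [apply Cmod_ge_0|apply H]. }
      unfold plus; simpl; lra. }
  replace l with (csum a N + - (csum a N - l))%C by ring.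
  eapply Rle_trans; [apply Cmod_triangle|]. rewrite Cmod_opp. lra.
Qed.

Lemma cseries_exists (a : nat -> C) (b : nat -> R) :
  (forall k, Cmod (a k) <= b k) -> ex_series b -> exists l, cseries a l.
Proof.
  intros H Hb.
  (* Completeness is taken from C as a real normed module; the convergence of partial sums is the
     same statement over either scalar field. *)
  destruct (ex_series_le (V := C_R_CompleteNormedModule) a b) as [l Hl].
  - intros n. eapply Rle_trans; [|apply (H n)]. right. symmetry. exact (Cmod_norm (a n)).
  - exact Hb.
  - exists l. exact Hl.
Qed.

Lemma cseries_bounded (a : nat -> C) (l : C) :
  cseries a l -> exists M, forall n, Cmod (a n) <= M.
Proof.
  intros H.
  destruct (filterlim_bounded (V := C_NormedModule) (sum_n a)) as [M HM].
  { exists l. exact H. }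
  change (forall n, Cmod (csum a n) <= M) in HM.
  exists (2 * M). intros [|n].
  - specialize (HM 0%nat). rewrite sum_O in HM.
    assert (A := Cmod_ge_0 (a 0%nat)). lra.
  - assert (H1 := HM n). assert (H2 := HM (S n)). rewrite sum_Sn in H2.
    change (Cmod (csum a n + a (S n))%C <= M) in H2.
    replace (a (S n)) with ((csum a n + a (S n)) + - csum a n)%C by ring.
    eapply Rle_trans; [apply Cmod_triangle|]. rewrite Cmod_opp. lra.
Qed.

Lemma Cmod_cpow (h : C) (n : nat) : Cmod (cpow h n) = Cmod h ^ n.
Proof.
  induction n as [|n IH]; [exact Cmod_1|].
  change (Cmod (h * cpow h n)%C = Cmod h * Cmod h ^ n). rewrite Cmod_mult, IH.
  reflexivity.
Qed.

(** With E_m the remainder at exponent m, E_(m+1) = k E_m + m h^(m-1) (k - h)^2, and m (m-1) + m <=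
    (m+1) m. The exponent is n + 2 to avoid truncated subtraction. *)
Lemma cpow_taylor (h k : C) (rho : R) (n : nat) :
  Cmod h <= rho -> Cmod k <= rho ->
  Cmod (cpow k (S (S n)) - cpow h (S (S n))
        - INR (S (S n)) * cpow h (S n) * (k - h))%C
  <= INR (S (S n)) * INR (S n) * rho ^ n * Cmod (k - h)%C ^ 2.
Proof.
  intros Hh Hk.
  assert (Hrho : 0 <= rho) by (eapply Rle_trans; [apply Cmod_ge_0|exact Hh]).
  induction n as [|n IH].
  - replace (cpow k 2 - cpow h 2 - INR 2 * cpow h 1 * (k - h))%C
      with ((k - h) * (k - h))%C.
    + rewrite Cmod_mult. simpl. assert (A := Cmod_ge_0 (k - h)%C). nra.
    + change (((k - h) * (k - h) = k * (k * 1) - h * (h * 1) -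
        INR 2 * (h * 1) * (k - h))%C).
      replace (RtoC (INR 2)) with (1 + 1)%C; [ring|].
      unfold RtoC, Cplus; simpl. f_equal; ring.
  - set (m := S (S n)) in *.
    set (E := (cpow k m - cpow h m - INR m * cpow h (S n) * (k - h))%C) in *.
    replace (cpow k (S m) - cpow h (S m) - INR (S m) * cpow h m * (k - h))%C
      with (k * E + INR m * cpow h (S n) * ((k - h) * (k - h)))%C.
    + eapply Rle_trans; [apply Cmod_triangle|]. rewrite !Cmod_mult, Cmod_R, Cmod_cpow.
      rewrite (Rabs_pos_eq (INR m)) by apply pos_INR.
      assert (Hd := Cmod_ge_0 (k - h)%C).
      assert (Hd2 : 0 <= Cmod (k - h)%C * Cmod (k - h)%C) by nra.
      assert (P1 : Cmod h ^ S n <= rho ^ S n)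
        by (apply pow_incr; split; [apply Cmod_ge_0|exact Hh]).
      assert (P2 : 0 <= rho ^ S n) by (apply pow_le; exact Hrho).
      assert (Hm : 0 <= INR m) by apply pos_INR.
      apply Rle_trans with (rho * (INR m * INR (S n) * rho ^ n * Cmod (k - h)%C ^ 2)
        + INR m * rho ^ S n * (Cmod (k - h)%C * Cmod (k - h)%C)).
      * apply Rplus_le_compat.
        { apply Rmult_le_compat; [apply Cmod_ge_0|apply Cmod_ge_0|exact Hk|exact IH]. }
        { apply Rmult_le_compat_r; [exact Hd2|]. apply Rmult_le_compat_l; assumption. }
      * replace (INR (S m)) with (INR m + 1) by (rewrite (S_INR m); ring).
        replace (INR m) with (INR (S n) + 1) in * by (unfold m; rewrite (S_INR (S n)); ring).
        set (x := INR (S n)) in *. set (q := rho ^ S n) in *.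
        assert (Hx : 0 <= x) by apply pos_INR.
        replace (rho * ((x + 1) * x * rho ^ n * Cmod (k - h)%C ^ 2))
          with ((x + 1) * x * q * (Cmod (k - h)%C * Cmod (k - h)%C))
          by (unfold q; simpl; ring).
        assert (0 <= (x + 1) * (q * (Cmod (k - h)%C * Cmod (k - h)%C)))
          by (apply Rmult_le_pos; [lra|]; apply Rmult_le_pos; assumption).
        nra.
    + change (cpow k (S m)) with (k * cpow k m)%C.
      change (cpow h (S m)) with (h * cpow h m)%C.
      unfold E.
      change (cpow h m) with (h * cpow h (S n))%C.
      replace (INR (S m)) with (INR m + 1) by (rewrite (S_INR m); ring).
      rewrite RtoC_plus. ring.
Qed.

Definition dseries (a : nat -> C) (n : nat) : C := (INR (S n) * a (S n))%C.

Section DSeries.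

Variables (a : nat -> C) (z0 : C) (r : R) (g : C -> C).
Hypothesis Hg : forall z, Cmod (z - z0)%C < r -> cpseries a (z - z0)%C (g z).

(** These are (n+1)(n+2)|a_(n+2)|, the weights produced by [cpow_taylor]; as a formal second
    derivative they inherit the radius of convergence. *)
Let D2 (n : nat) : R := PS_derive (PS_derive (fun n => Cmod (a n))) n.

(** Convergence at the single point z0 + rho, with x < rho < r, bounds |a_n| rho^n; the midpoint
    makes the inequality strict. *)
Lemma dseries_radius (x : R) :
  0 <= x < r -> Rbar_lt (Rabs x) (CV_radius (fun n => Cmod (a n))).
Proof.
  intros [Hx0 Hx]. rewrite Rabs_pos_eq by exact Hx0.
  set (rho := (x + r) / 2).
  apply Rbar_lt_le_trans with (Finite rho); [unfold rho; simpl; lra|].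
  apply (proj1 (CV_radius_bounded (fun n => Cmod (a n)))).
  assert (Hc : Cmod (z0 + rho - z0)%C = rho).
  { replace (z0 + rho - z0)%C with (RtoC rho) by ring.
    rewrite Cmod_R, Rabs_pos_eq; unfold rho; lra. }
  destruct (cseries_bounded _ _ (Hg (z0 + rho)%C ltac:(rewrite Hc; unfold rho; lra)))
    as [M HM].
  exists M. intros n. specialize (HM n).
  change (Cmod (cpow (z0 + rho - z0)%C n * a n)%C <= M) in HM.
  rewrite Cmod_mult, Cmod_cpow, Hc in HM.
  rewrite Rabs_pos_eq; [lra|]. apply Rmult_le_pos; [apply Cmod_ge_0|].
  apply pow_le. unfold rho; lra.
Qed.

Lemma D2_pos (n : nat) : 0 <= D2 n.
Proof.
  unfold D2, PS_derive. repeat apply Rmult_le_pos; try apply pos_INR. apply Cmod_ge_0.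
Qed.

Lemma D2_ex (x : R) : 0 <= x < r -> ex_series (fun n => D2 n * x ^ n).
Proof.
  intros Hx.
  apply ex_series_ext with (fun n => Rabs (D2 n * x ^ n)).
  { intros n. apply Rabs_pos_eq. apply Rmult_le_pos; [apply D2_pos|].
    apply pow_le; lra. }
  apply CV_disk_inside. unfold D2. rewrite !CV_radius_derive. apply dseries_radius.
  exact Hx.
Qed.

Lemma dseries_conv (z : C) :
  Cmod (z - z0)%C < r -> exists l, cpseries (dseries a) (z - z0)%C l.
Proof.
  intros Hz. assert (H0 := Cmod_ge_0 (z - z0)%C).
  apply cseries_exists with
    (fun n => Rabs (PS_derive (fun n => Cmod (a n)) n * Cmod (z - z0)%C ^ n)).
  - intros n. change (Cmod (cpow (z - z0)%C n * (INR (S n) * a (S n)))%C <=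
      Rabs (INR (S n) * Cmod (a (S n)) * Cmod (z - z0)%C ^ n)).
    rewrite !Cmod_mult, Cmod_cpow, Cmod_R, !Rabs_mult.
    rewrite (Rabs_pos_eq (Cmod (a (S n)))) by apply Cmod_ge_0.
    rewrite (Rabs_pos_eq (Cmod (z - z0)%C ^ n)) by (apply pow_le; exact H0). lra.
  - apply CV_disk_inside. rewrite CV_radius_derive. apply dseries_radius. lra.
Qed.

(** The remainder is itself a series, each of whose terms is second order in w - z; the constant
    depends only on [rho]. *)
Lemma dseries_bound (rho : R) (z w l : C) :
  rho < r -> Cmod (z - z0)%C <= rho -> Cmod (w - z0)%C <= rho ->
  cpseries (dseries a) (z - z0)%C l ->
  Cmod (g w - g z - l * (w - z))%C <=
    Series (fun n => D2 n * rho ^ n) * Cmod (w - z)%C ^ 2.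
Proof.
  intros Hr Hz Hw Hl.
  assert (Hrho : 0 <= rho) by (eapply Rle_trans; [apply Cmod_ge_0|exact Hz]).
  assert (Gz := Hg z ltac:(lra)). assert (Gw := Hg w ltac:(lra)).
  set (h := (z - z0)%C) in *. set (k := (w - z0)%C) in *.
  replace (w - z)%C with (k - h)%C by (unfold h, k; ring).
  rewrite <- Series_scal_r.
  assert (T : forall x gx : C, cpseries a x gx ->
    cseries (fun n => (cpow x (S n) * a (S n))%C) (gx - a 0%nat)%C).
  { intros x gx H. apply (is_series_incr_1 (V := C_NormedModule)
      (fun n => (cpow x n * a n)%C)).
    change (cseries (fun n => (cpow x n * a n)%C) ((gx - a 0%nat) + 1 * a 0%nat)%C).
    replace ((gx - a 0%nat) + 1 * a 0%nat)%C with gx by ring. exact H. }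
  assert (S1 := is_series_minus _ _ _ _
    (is_series_minus _ _ _ _ (T _ _ Gw) (T _ _ Gz))
    (is_series_scal (V := C_NormedModule) (k - h)%C _ _ Hl)).
  set (t := fun n => (a (S n) * (cpow k (S n) - cpow h (S n)
    - INR (S n) * cpow h n * (k - h)))%C).
  assert (S2 : cseries t (g w - g z - l * (k - h))%C).
  { replace (g w - g z - l * (k - h))%C with
      ((g w - a 0%nat) + - (g z - a 0%nat) + - ((k - h) * l))%C by ring.
    eapply is_series_ext; [|exact S1]. intros n. unfold t.
    change ((cpow k (S n) * a (S n) + - (cpow h (S n) * a (S n)) +
      - ((k - h) * (cpow h n * (INR (S n) * a (S n)))))%C =
      (a (S n) * (cpow k (S n) - cpow h (S n) - INR (S n) * cpow h n * (k - h)))%C).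
    ring. }
  (* The degree-one term of the remainder vanishes, so dropping it keeps the sum and leaves the
     exponents n + 2. *)
  assert (S3 : cseries (fun n => t (S n)) (g w - g z - l * (k - h))%C).
  { apply (is_series_incr_1 (V := C_NormedModule) t).
    change (cseries t ((g w - g z - l * (k - h)) + a 1%nat *
      (k * 1 - h * 1 - 1 * 1 * (k - h)))%C).
    replace ((g w - g z - l * (k - h)) + a 1%nat * (k * 1 - h * 1 - 1 * 1 * (k - h)))%C
      with (g w - g z - l * (k - h))%C by ring. exact S2. }
  apply cseries_le with (3 := S3).
  - intros n. unfold t. rewrite Cmod_mult.
    replace (D2 n * rho ^ n * Cmod (k - h)%C ^ 2) with
      (Cmod (a (S (S n))) *
        (INR (S (S n)) * INR (S n) * rho ^ n * Cmod (k - h)%C ^ 2))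
      by (unfold D2, PS_derive; ring).
    apply Rmult_le_compat_l; [apply Cmod_ge_0|]. apply cpow_taylor; assumption.
  - apply ex_series_scal_r. apply D2_ex. lra.
Qed.

Lemma dseries_cderiv (z l : C) :
  Cmod (z - z0)%C < r -> cpseries (dseries a) (z - z0)%C l -> cderiv g z l.
Proof.
  intros Hz Hl. apply cderiv_iff. intros e He.
  set (rho := (Cmod (z - z0)%C + r) / 2).
  assert (H0 := Cmod_ge_0 (z - z0)%C).
  set (B := Series (fun n => D2 n * rho ^ n)).
  (* The estimate itself, at a second point within [rho] of the centre, bounds a nonnegative number
     by [B] times a positive one. *)
  assert (HB : 0 <= B).
  { assert (A := dseries_bound rho z (z + (rho - Cmod (z - z0))%R)%C l).
    replace (z + (rho - Cmod (z - z0))%R - z)%C with (RtoC (rho - Cmod (z - z0)%C)) in A by ring.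
    rewrite Cmod_R, Rabs_pos_eq in A by (unfold rho; lra).
    apply Rmult_le_reg_r with ((rho - Cmod (z - z0)%C) ^ 2);
      [apply pow_lt; unfold rho; lra|].
    rewrite Rmult_0_l. eapply Rle_trans; [apply Cmod_ge_0|]. apply A.
    - unfold rho; lra.
    - unfold rho; lra.
    - replace (z + (rho - Cmod (z - z0))%R - z0)%C with
        ((z - z0) + RtoC (rho - Cmod (z - z0)%C))%C by ring.
      eapply Rle_trans; [apply Cmod_triangle|].
      rewrite Cmod_R, Rabs_pos_eq by (unfold rho; lra). lra.
    - exact Hl. }
  apply near_iff. exists (Rmin (rho - Cmod (z - z0)%C) (e / (B + 1))). split.
  { apply Rmin_glb_lt; [unfold rho; lra|apply Rdiv_lt_0_compat; lra]. }
  intros w Hw.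
  assert (W1 := Rlt_le_trans _ _ _ Hw (Rmin_l _ _)).
  assert (W2 := Rlt_le_trans _ _ _ Hw (Rmin_r _ _)).
  eapply Rle_trans; [apply (dseries_bound rho z w l)|].
  - unfold rho; lra.
  - unfold rho; lra.
  - replace (w - z0)%C with ((z - z0) + (w - z))%C by ring.
    eapply Rle_trans; [apply Cmod_triangle|]. lra.
  - exact Hl.
  - fold B. assert (Hd := Cmod_ge_0 (w - z)%C).
    assert ((B + 1) * Cmod (w - z)%C <= e).
    { apply Rlt_le. replace e with ((B + 1) * (e / (B + 1))) by (field; lra).
      apply Rmult_lt_compat_l; lra. }
    nra.
Qed.

End DSeries.

(** The derivative is again the sum of a power series on the same disk, so the induction never
    shrinks the radius. *)
Lemma pseries_smooth (n : nat) (a : nat -> C) (z0 : C) (r : R) (g : C -> C) :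
  0 < r -> (forall z, Cmod (z - z0)%C < r -> cpseries a (z - z0)%C (g z)) ->
  smooth n g z0.
Proof.
  intros Hr. revert a g. induction n as [|n IH]; [easy|]. intros a g Hg.
  assert (H : forall z : C, exists l : C,
    Cmod (z - z0)%C < r -> cpseries (dseries a) (z - z0)%C l).
  { intros z. destruct (Rlt_dec (Cmod (z - z0)%C) r) as [Hz|Hz].
    - destruct (dseries_conv a z0 r g Hg z Hz) as [l Hl]. exists l. easy.
    - exists (RtoC 0). easy. }
  destruct (functional_choice _ H) as [g' Hg']. exists g'. split.
  - apply near_iff. exists r. split; [exact Hr|]. intros w Hw.
    apply dseries_cderiv with a z0 r; [exact Hg|exact Hw|]. apply Hg'. exact Hw.
  - apply IH with (dseries a). exact Hg'.
Qed.

Lemma analytic_smooth (n : nat) (f : C -> C) (z : C) : analytic_at f z -> smooth n f z.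
Proof.
  intros [a [r H]]. apply pseries_smooth with a r; [apply cond_pos|exact H].
Qed.

(** Since f(0) = 0 kills the constant coefficient, the quotient is the sum of the shifted series,
    also at 0, where it takes the value a_1. *)
Lemma analytic_div_id (n : nat) (f : C -> C) :
  analytic_at f 0%C -> f 0%C = 0%C ->
  exists F, smooth n F 0%C /\ near (RtoC 0) (fun w => f w = (w * F w)%C).
Proof.
  intros [a [r H]] H0.
  assert (Ha : a 0%nat = RtoC 0).
  { rewrite <- H0. apply cseries_unique with (fun k => (cpow (0 - 0)%C k * a k)%C).
    - replace (0 - 0)%C with (RtoC 0) by ring.
      exact (is_pseries_0 (V := C_NormedModule) a).
    - apply H. replace (0 - 0)%C with (RtoC 0) by ring. rewrite Cmod_0. apply cond_pos. }
  set (F := fun w => if Ceq_dec w 0%C then a 1%nat else (f w / w)%C).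
  exists F. split.
  - apply pseries_smooth with (PS_decr_1 a) r; [apply cond_pos|].
    intros z Hz. unfold F. destruct (Ceq_dec z 0%C) as [->|N].
    + replace (0 - 0)%C with (RtoC 0) by ring.
      exact (is_pseries_0 (V := C_NormedModule) (PS_decr_1 a)).
    + specialize (H z Hz). replace (z - 0)%C with z in H |- * by ring.
      replace (f z / z)%C with (/ z * (f z + - a 0%nat))%C
        by (rewrite Ha; field; exact N).
      refine (is_pseries_decr_1 (V := C_NormedModule) a z (/ z)%C (f z) _ H).
      exact (Cinv_l z N).
  - apply filter_forall. intros w. unfold F. destruct (Ceq_dec w 0%C) as [->|N].
    + rewrite H0. ring.
    + field. exact N.
Qed.

(** * Exponential, logarithm and powers *)

Lemma Cexp_plus (z w : C) : Cexp (z + w)%C = (Cexp z * Cexp w)%C.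
Proof.
  unfold Cexp, Re, Im, Cplus, Cmult. simpl.
  rewrite exp_plus, cos_plus, sin_plus. f_equal; ring.
Qed.

Lemma Cmod_Cexp (z : C) : Cmod (Cexp z) = exp (Re z).
Proof.
  rewrite <- (Rabs_pos_eq (exp (Re z))) by (left; apply exp_pos).
  rewrite <- sqrt_Rsqr_abs. unfold Cmod. f_equal. unfold Cexp, Rsqr. simpl.
  assert (H := sin2_cos2 (Im z)). unfold Rsqr in H.
  replace (exp (Re z) * cos (Im z) * (exp (Re z) * cos (Im z) * 1) +
    exp (Re z) * sin (Im z) * (exp (Re z) * sin (Im z) * 1)) with
    (exp (Re z) * exp (Re z) * (sin (Im z) * sin (Im z) + cos (Im z) * cos (Im z))) by ring.
  rewrite H. ring.
Qed.

Lemma Cexp_neq0 (z : C) : Cexp z <> 0%C.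
Proof. apply Cmod_gt_0. rewrite Cmod_Cexp. apply exp_pos. Qed.

Lemma derive_near (f : R -> R) (x l e : R) :
  is_derive f x l -> 0 < e ->
  exists d, 0 < d /\ forall y, Rabs y < d -> Rabs (f (x + y) - f x - l * y) <= e * Rabs y.
Proof.
  intros H He. apply is_derive_Reals in H. destruct (H e He) as [d Hd].
  exists d. split; [apply cond_pos|]. intros y Hy.
  destruct (Req_dec y 0) as [->|N].
  { rewrite Rplus_0_r, Rmult_0_r, Rabs_R0. replace (f x - f x - 0) with 0 by ring.
    rewrite Rabs_R0. lra. }
  specialize (Hd y N Hy).
  replace (f (x + y) - f x - l * y) with (((f (x + y) - f x) / y - l) * y) by (field; exact N).
  rewrite Rabs_mult. apply Rmult_le_compat_r; [apply Rabs_pos|lra].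
Qed.

Lemma Cexp_near_0 (e : R) :
  0 < e -> near (RtoC 0) (fun h => Cmod (Cexp h - 1 - h)%C <= e * Cmod h).
Proof.
  (* The errors in the real and imaginary parts are at most 4 e' |h| and 5 e' |h|, hence the 9. The
     cap 1, with |h| < e', gives exp x <= 3 and |exp x - 1| <= 2 e'. *)
  intros He. set (e' := Rmin 1 (e / 9)).
  assert (He' : 0 < e') by (apply Rmin_glb_lt; lra).
  assert (He1 : e' <= 1) by apply Rmin_l.
  assert (He9 : e' <= e / 9) by apply Rmin_r.
  destruct (derive_near exp 0 1 e') as [d1 [Hd1 H1]]; [|exact He'|].
  { rewrite <- exp_0. apply is_derive_exp. }
  destruct (derive_near sin 0 1 e') as [d2 [Hd2 H2]]; [|exact He'|].
  { rewrite <- cos_0. apply is_derive_sin. }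
  destruct (derive_near cos 0 0 e') as [d3 [Hd3 H3]]; [|exact He'|].
  { replace 0 with (- sin 0) at 2 by (rewrite sin_0; ring). apply is_derive_cos. }
  apply near_iff. exists (Rmin (Rmin d1 e') (Rmin d2 d3)). split.
  { apply Rmin_glb_lt; apply Rmin_glb_lt; assumption. }
  intros h Hh. replace (h - 0)%C with h in Hh by ring.
  assert (A := Rmin_l (Rmin d1 e') (Rmin d2 d3)). assert (B := Rmin_r (Rmin d1 e') (Rmin d2 d3)).
  assert (A1 := Rmin_l d1 e'). assert (A2 := Rmin_r d1 e').
  assert (B1 := Rmin_l d2 d3). assert (B2 := Rmin_r d2 d3).
  assert (X := Rmax_Cmod h).
  assert (X1 := Rle_trans _ _ _ (Rmax_l _ _) X).
  assert (X2 := Rle_trans _ _ _ (Rmax_r _ _) X). clear X.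
  destruct h as [x y]. simpl in X1, X2.
  specialize (H1 x ltac:(lra)). specialize (H2 y ltac:(lra)). specialize (H3 y ltac:(lra)).
  rewrite Rplus_0_l, exp_0 in H1. rewrite Rplus_0_l, sin_0 in H2.
  rewrite Rplus_0_l, cos_0 in H3.
  set (m := Cmod (x, y)) in *.
  replace (Cexp (x, y) - 1 - (x, y))%C with (RtoC (exp x * cos y - 1 - x) +
    Ci * RtoC (exp x * sin y - y))%C
    by (apply injective_projections; simpl; ring).
  eapply Rle_trans; [apply Cmod_triangle|].
  rewrite Cmod_mult, Cmod_Ci, !Cmod_R, Rmult_1_l.
  assert (P1 := Rabs_pos x). assert (P2 := Rabs_pos y).
  assert (Q1 : Rabs (exp x - 1 - 1 * x) <= e' * m) by nra.
  assert (Q2 : Rabs (sin y - 0 - 1 * y) <= e' * m) by nra.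
  assert (Q3 : Rabs (cos y - 1 - 0 * y) <= e' * m) by nra.
  assert (Q4 : Rabs (exp x) <= 3).
  { replace (exp x) with ((exp x - 1 - 1 * x) + (1 + x)) by ring.
    eapply Rle_trans; [apply Rabs_triang|].
    assert (Rabs (1 + x) <= 1 + Rabs x)
      by (eapply Rle_trans; [apply Rabs_triang|rewrite Rabs_R1; lra]).
    nra. }
  assert (Q5 : Rabs (exp x - 1) <= 2 * e').
  { replace (exp x - 1) with ((exp x - 1 - 1 * x) + x) by ring.
    eapply Rle_trans; [apply Rabs_triang|]. nra. }
  assert (R1 : Rabs (exp x * cos y - 1 - x) <= 4 * (e' * m)).
  { replace (exp x * cos y - 1 - x) with
      ((exp x - 1 - 1 * x) + exp x * (cos y - 1 - 0 * y)) by ring.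
    eapply Rle_trans; [apply Rabs_triang|]. rewrite Rabs_mult.
    assert (Rabs (exp x) * Rabs (cos y - 1 - 0 * y) <= 3 * (e' * m))
      by (apply Rmult_le_compat; try apply Rabs_pos; assumption). lra. }
  assert (R2 : Rabs (exp x * sin y - y) <= 5 * (e' * m)).
  { replace (exp x * sin y - y) with
      (exp x * (sin y - 0 - 1 * y) + (exp x - 1) * y) by ring.
    eapply Rle_trans; [apply Rabs_triang|]. rewrite !Rabs_mult.
    assert (Rabs (exp x) * Rabs (sin y - 0 - 1 * y) <= 3 * (e' * m))
      by (apply Rmult_le_compat; try apply Rabs_pos; assumption).
    assert (Rabs (exp x - 1) * Rabs y <= 2 * e' * m)
      by (apply Rmult_le_compat; try apply Rabs_pos; assumption). lra. }
  assert (0 <= m) by lra. nra.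
Qed.

Lemma cderiv_Cexp (z : C) : cderiv Cexp z (Cexp z).
Proof.
  apply cderiv_iff. intros e He.
  assert (H0 := proj1 (Cmod_gt_0 _) (Cexp_neq0 z)).
  assert (H := Cexp_near_0 (e / Cmod (Cexp z)) ltac:(apply Rdiv_lt_0_compat; lra)).
  apply near_iff in H. destruct H as [d [Hd H]]. apply near_iff. exists d.
  split; [exact Hd|]. intros w Hw.
  specialize (H (w - z)%C). replace (w - z - 0)%C with (w - z)%C in H by ring.
  specialize (H Hw).
  replace w with (z + (w - z))%C at 1 by ring. rewrite Cexp_plus.
  replace (Cexp z * Cexp (w - z) - Cexp z - Cexp z * (w - z))%C
    with (Cexp z * (Cexp (w - z) - 1 - (w - z)))%C by ring.
  rewrite Cmod_mult.
  apply Rmult_le_compat_l with (r := Cmod (Cexp z)) in H; [|lra].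
  replace (e * Cmod (w - z)%C) with
    (Cmod (Cexp z) * (e / Cmod (Cexp z) * Cmod (w - z)%C)) by (field; lra).
  exact H.
Qed.

Lemma re_pos_neq0 (w : C) : 0 < Re w -> w <> 0%C.
Proof. intros H E. rewrite E in H. simpl in H. lra. Qed.

Lemma re_div_Cmod (w : C) : 0 < Re w -> 0 < Re w / Cmod w <= 1.
Proof.
  intros H. assert (H0 := proj1 (Cmod_gt_0 _) (re_pos_neq0 w H)).
  assert (H1 := Rle_trans _ _ _ (Rle_abs _) (re_le_Cmod w)).
  split; [apply Rdiv_lt_0_compat; lra|].
  apply (Rmult_le_reg_r (Cmod w)); [lra|]. unfold Rdiv.
  rewrite Rmult_assoc, Rinv_l by lra. lra.
Qed.

Lemma sqrt_re_div_Cmod (w : C) :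
  0 < Re w -> sqrt (1 - (Re w / Cmod w)²) = Rabs (Im w) / Cmod w.
Proof.
  intros H. assert (H0 := proj1 (Cmod_gt_0 _) (re_pos_neq0 w H)).
  replace (1 - (Re w / Cmod w)²) with ((Im w / Cmod w)²).
  - rewrite sqrt_Rsqr_abs. unfold Rdiv. rewrite Rabs_mult, Rabs_inv.
    rewrite (Rabs_pos_eq (Cmod w)) by lra. reflexivity.
  - assert (E := Cmod2_alt w). unfold Rsqr.
    apply (Rmult_eq_reg_r (Cmod w ^ 2)); [|apply pow_nonzero; lra].
    replace ((1 - Re w / Cmod w * (Re w / Cmod w)) * Cmod w ^ 2) with
      (Cmod w ^ 2 - Re w ^ 2) by (field; lra).
    replace (Im w / Cmod w * (Im w / Cmod w) * Cmod w ^ 2) with (Im w ^ 2) by (field; lra).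
    lra.
Qed.

(** The case split in [Carg] hides its continuity across the positive real axis; the arctangent form
    shows it. *)
Lemma Carg_atan (w : C) : 0 < Re w -> Carg w = atan (Im w / Re w).
Proof.
  intros H. assert (H0 := proj1 (Cmod_gt_0 _) (re_pos_neq0 w H)).
  assert (H1 := re_div_Cmod w H).
  unfold Carg. rewrite acos_atan, sqrt_re_div_Cmod by lra.
  replace (Rabs (Im w) / Cmod w / (Re w / Cmod w)) with (Rabs (Im w) / Re w)
    by (field; lra).
  destruct (Rle_dec 0 (Im w)) as [L|L].
  - rewrite Rabs_pos_eq by exact L. reflexivity.
  - rewrite Rabs_left by lra. rewrite <- atan_opp. f_equal. field. lra.
Qed.

Lemma Cexp_Clog (w : C) : 0 < Re w -> Cexp (Clog w) = w.
Proof.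
  intros H. assert (H0 := proj1 (Cmod_gt_0 _) (re_pos_neq0 w H)).
  assert (H1 := re_div_Cmod w H).
  assert (B : -1 <= Re w / Cmod w <= 1) by lra.
  unfold Cexp, Clog.
  change (Re (ln (Cmod w), Carg w)) with (ln (Cmod w)).
  change (Im (ln (Cmod w), Carg w)) with (Carg w).
  rewrite exp_ln by lra.
  transitivity (Re w, Im w); [|destruct w; reflexivity].
  unfold Carg. destruct (Rle_dec 0 (Im w)) as [L|L].
  - rewrite cos_acos, sin_acos, sqrt_re_div_Cmod, Rabs_pos_eq by lra.
    f_equal; field; lra.
  - rewrite cos_neg, sin_neg, cos_acos, sin_acos, sqrt_re_div_Cmod, Rabs_left by lra.
    f_equal; field; lra.
Qed.

(** * Continuity and derivatives of the principal logarithm and powers *)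

Lemma near_re (f : C -> C) (z : C) (e : R) :
  cont f z -> 0 < e -> near z (fun w => Rabs (Re (f w) - Re (f z)) < e).
Proof.
  intros H He. apply cont_iff with (e := e) in H; [|exact He]. revert H.
  apply filter_imp. intros w Hw. eapply Rle_lt_trans; [|exact Hw].
  apply (re_le_Cmod (f w - f z)%C).
Qed.

Lemma continuous_re (z : C) : @continuous CK R_UniformSpace Re z.
Proof.
  intros P [e He]. unfold filtermap.
  generalize (near_re (fun w => w) z e (continuous_id _) (cond_pos e)).
  apply filter_imp. intros w Hw. apply He. exact Hw.
Qed.

Lemma continuous_im (z : C) : @continuous CK R_UniformSpace Im z.
Proof.
  intros P [e He]. apply near_iff. exists e. split; [apply cond_pos|].
  intros w Hw. apply He. eapply Rle_lt_trans; [|exact Hw].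
  exact (Rle_trans _ _ _ (Rmax_r _ _) (Rmax_Cmod (w - z)%C)).
Qed.

Lemma continuous_Cmod (z : C) : @continuous CK R_UniformSpace Cmod z.
Proof.
  intros P [e He]. apply near_iff. exists e. split; [apply cond_pos|].
  intros w Hw. apply He. eapply Rle_lt_trans; [|exact Hw].
  change (Rabs (Cmod w - Cmod z) <= Cmod (w - z)%C).
  assert (A : Cmod w <= Cmod z + Cmod (w - z)%C).
  { replace w with (z + (w - z))%C at 1 by ring. apply Cmod_triangle. }
  assert (B : Cmod z <= Cmod w + Cmod (w - z)%C).
  { replace z with (w + - (w - z))%C at 1 by ring.
    eapply Rle_trans; [apply Cmod_triangle|]. rewrite Cmod_opp. lra. }
  apply Rabs_le. lra.
Qed.

Lemma near_re_pos (f : C -> C) (z : C) :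
  cont f z -> 0 < Re (f z) -> near z (fun w => 0 < Re (f w)).
Proof.
  intros H H0. generalize (near_re f z _ H H0). apply filter_imp. intros w Hw.
  apply Rabs_lt_between in Hw. lra.
Qed.

Lemma continuous_Carg (w : C) : 0 < Re w -> @continuous CK R_UniformSpace Carg w.
Proof.
  intros H.
  apply (continuous_ext_loc (T := CK) (U := R_UniformSpace) Carg
    (fun v => atan (Im v * / Re v)%R) w).
  { generalize (near_re_pos (fun v => v) w (continuous_id _) H).
    apply filter_imp. intros v Hv. symmetry. apply (Carg_atan v Hv). }
  apply (continuous_comp (U := CK) (V := R_UniformSpace) (W := R_UniformSpace) (fun v => Im v * / Re v)%R atan).
  - apply (continuous_mult (U := CK) (K := R_AbsRing) Im (fun v => / Re v)%R).
    + apply continuous_im.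
    + apply (continuous_comp (U := CK) (V := R_UniformSpace) (W := R_UniformSpace) Re Rinv).
      * apply continuous_re.
      * apply (continuous_Rinv (Re w)). lra.
  - apply (ex_derive_continuous (V := R_NormedModule)). eexists.
    apply is_derive_atan.
Qed.

Lemma continuous_Clog (w : C) : 0 < Re w -> cont Clog w.
Proof.
  intros H. assert (H0 := proj1 (Cmod_gt_0 _) (re_pos_neq0 w H)).
  assert (L : @continuous CK R_UniformSpace (fun v => ln (Cmod v)) w).
  { apply (continuous_comp (U := CK) (V := R_UniformSpace) (W := R_UniformSpace) Cmod ln).
    - apply continuous_Cmod.
    - apply (ex_derive_continuous (V := R_NormedModule)). eexists.
      apply is_derive_ln. exact H0. }
  assert (A := continuous_Carg w H).
  apply cont_iff. intros e He.
  assert (He2 : 0 < e / 2) by lra.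
  assert (L' := proj1 (filterlim_locally _ _) L (mkposreal _ He2)).
  assert (A' := proj1 (filterlim_locally _ _) A (mkposreal _ He2)).
  generalize (filter_and _ _ L' A'). apply filter_imp. intros v [V1 V2].
  replace e with (2 * (e / 2)) by field.
  apply Cmod_le_2max; [exact V1|exact V2].
Qed.

(** Inverse function argument: with d = log v - log w, differentiability of [Cexp] gives v - w - w d
    = o(d), continuity of [Clog] makes d small, and |d| is controlled by |v - w|. *)
Lemma cderiv_Clog (w : C) : 0 < Re w -> cderiv Clog w (/ w)%C.
Proof.
  intros H. assert (Hw0 := re_pos_neq0 w H).
  assert (H0 := proj1 (Cmod_gt_0 _) Hw0).
  apply cderiv_iff. intros e He.
  set (m := Cmod w) in *.
  (* The bound m/2 absorbs the error and yields m |d| <= 2 |v - w|; the other bound then gives the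
     required [e]. *)
  set (e' := Rmin (m / 2) (e * m ^ 2 / 2)).
  assert (He' : 0 < e').
  { apply Rmin_glb_lt; [lra|]. apply Rdiv_lt_0_compat; [|lra].
    apply Rmult_lt_0_compat; [exact He|]. apply pow_lt; exact H0. }
  assert (E1 : e' <= m / 2) by apply Rmin_l.
  assert (E2 : e' <= e * m ^ 2 / 2) by apply Rmin_r.
  assert (D := proj1 (cderiv_iff _ _ _) (cderiv_Cexp (Clog w)) e' He').
  assert (D' := continuous_Clog w H _ D). unfold filtermap in D'.
  generalize (filter_and _ _ D' (near_re_pos (fun v => v) w (continuous_id _) H)).
  apply filter_imp. intros v [V1 V2].
  rewrite !Cexp_Clog in V1 by assumption.
  set (d := (Clog v - Clog w)%C) in *.
  assert (Hd := Cmod_ge_0 d). assert (Hv := Cmod_ge_0 (v - w)%C).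
  assert (B : Cmod (w * d)%C <= Cmod (v - w)%C + Cmod (v - w - w * d)%C).
  { replace (w * d)%C with ((v - w) + - (v - w - w * d))%C at 1 by ring.
    eapply Rle_trans; [apply Cmod_triangle|]. rewrite Cmod_opp. lra. }
  rewrite Cmod_mult in B. fold m in B.
  assert (B2 : m * Cmod d <= 2 * Cmod (v - w)%C) by nra.
  replace (d - / w * (v - w))%C with (- ((v - w - w * d) / w))%C by (field; exact Hw0).
  rewrite Cmod_opp, Cmod_div by exact Hw0. fold m.
  apply (Rmult_le_reg_r m); [exact H0|]. unfold Rdiv.
  rewrite (Rmult_assoc _ (/ m)), Rinv_l, Rmult_1_r by lra.
  eapply Rle_trans; [exact V1|].
  apply Rle_trans with (e * m ^ 2 / 2 * Cmod d); [apply Rmult_le_compat_r; lra|].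
  replace (e * m ^ 2 / 2 * Cmod d) with (e * m / 2 * (m * Cmod d)) by field.
  replace (e * Cmod (v - w)%C * m) with (e * m / 2 * (2 * Cmod (v - w)%C)) by field.
  apply Rmult_le_compat_l; [|exact B2]. nra.
Qed.

Lemma Cpower_eq (w k : C) : w <> 0%C -> Cpower w k = Cexp (k * Clog w)%C.
Proof. intros H. unfold Cpower. destruct (Ceq_dec w 0%C); [easy|reflexivity]. Qed.

(** Keeping the exponent [k], with a factor 1/w instead of the exponent k - 1, lets the induction in
    [smooth_Cpower] reuse the same power. *)
Lemma cderiv_Cpower (w k : C) :
  0 < Re w -> cderiv (fun v => Cpower v k) w (k * / w * Cpower w k)%C.
Proof.
  intros H. assert (H0 := re_pos_neq0 w H).
  apply cderiv_ext with (fun v => Cexp (k * Clog v)%C).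
  - generalize (near_re_pos (fun v => v) w (continuous_id _) H).
    apply filter_imp. intros v Hv. symmetry. apply Cpower_eq. apply re_pos_neq0.
    exact Hv.
  - rewrite Cpower_eq by exact H0.
    replace (k * / w * Cexp (k * Clog w))%C with
      (Cexp (k * Clog w) * (0 * Clog w + k * / w))%C by ring.
    apply (cderiv_comp Cexp (fun v => k * Clog v)%C); [apply cderiv_Cexp|].
    apply (cderiv_mult (fun _ => k) Clog); [apply cderiv_const|].
    apply cderiv_Clog. exact H.
Qed.

Lemma cderiv_Cpower_comp (p : C -> C) (z l k : C) :
  0 < Re (p z) -> cderiv p z l ->
  cderiv (fun v => Cpower (p v) k) z (k * / p z * Cpower (p z) k * l)%C.
Proof.
  intros H Hp. apply (cderiv_comp (fun v => Cpower v k) p); [|exact Hp].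
  apply cderiv_Cpower. exact H.
Qed.

Lemma smooth_Cpower (n : nat) (p : C -> C) (z k : C) :
  0 < Re (p z) -> smooth n p z -> smooth n (fun w => Cpower (p w) k) z.
Proof.
  intros H0. induction n as [|n IH]; [easy|]. intros Hp.
  assert (N := near_re_pos _ _ (smooth_cont _ _ _ Hp) H0).
  assert (Hp0 := smooth_pred _ _ _ Hp). assert (IH' := IH Hp0).
  destruct Hp as [p' [Hp Hp']].
  exists (fun w => k * / p w * Cpower (p w) k * p' w)%C. split.
  - generalize (filter_and _ _ Hp N). apply filter_imp. intros w [A B].
    apply cderiv_Cpower_comp; assumption.
  - repeat apply smooth_mult; try assumption; [apply smooth_const|].
    apply smooth_inv; [apply re_pos_neq0; exact H0|exact Hp0].
Qed.

Lemma Cpower_real (w : C) (k : R) : 0 < Re w ->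
  Cmod (Cpower w (RtoC k)) = Rpower (Cmod w) k /\
  Re (Cpower w (RtoC k)) = Rpower (Cmod w) k * cos (k * Carg w).
Proof.
  intros H. rewrite Cpower_eq by (apply re_pos_neq0; exact H).
  rewrite Cmod_Cexp. unfold Cexp, Clog, Rpower, Re, Im. simpl.
  replace (k * ln (Cmod w) - 0 * Carg w) with (k * ln (Cmod w)) by ring.
  replace (k * Carg w + 0 * ln (Cmod w)) with (k * Carg w) by ring.
  split; reflexivity.
Qed.

Lemma Carg_1 : Carg (RtoC 1) = 0.
Proof.
  rewrite Carg_atan by (simpl; lra). simpl. rewrite Rdiv_0_l. apply atan_0.
Qed.

Lemma Cpower_1 (k : C) : Cpower (RtoC 1) k = RtoC 1.
Proof.
  rewrite Cpower_eq by (apply re_pos_neq0; simpl; lra).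
  unfold Clog. rewrite Carg_1, Cmod_1, ln_1.
  replace (k * (0, 0))%C with (RtoC 0) by (unfold RtoC, Cmult; simpl; f_equal; ring).
  unfold Cexp, RtoC. simpl. rewrite exp_0, cos_0, sin_0. f_equal; ring.
Qed.

(** * The functional z f'(z) / f(z) *)

Lemma zf'_over_f_0 (f : C -> C) : zf'_over_f f 0%C = 1%C.
Proof. unfold zf'_over_f. destruct (Ceq_dec 0%C 0%C); [reflexivity|easy]. Qed.

Lemma zf'_over_f_neq0 (f : C -> C) (z : C) :
  z <> 0%C -> zf'_over_f f z = (z * C_derive f z / f z)%C.
Proof. intros H. unfold zf'_over_f. destruct (Ceq_dec z 0%C); [easy|reflexivity]. Qed.

(** At the origin f = w F with F(0) = f'(0) = 1, so the functional equals f'/F near 0, including at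
    0, where the value assigned by definition is the right one. *)
Lemma zf'_over_f_smooth (f : C -> C) (z : C) (n : nat) :
  class_A f -> unit_disk z -> (z <> 0%C -> f z <> 0%C) ->
  smooth n (zf'_over_f f) z /\ near z (fun w : C => w <> 0%C -> f w <> 0%C).
Proof.
  intros [Hf [Hf0 Hf1]] Hz Hfz. unfold analytic_on in Hf.
  assert (Sf := fun m => analytic_smooth m f z (Hf z Hz)).
  destruct (Ceq_dec z 0%C) as [E|N].
  - subst z.
    destruct (analytic_div_id (S (S n)) f (Hf _ Hz) Hf0) as [F [HF HfF]].
    assert (F1 : F 0%C = 1%C).
    { rewrite <- Hf1. symmetry. apply cderiv_unique.
      apply cderiv_ext with (fun w => w * F w)%C.
      - revert HfF. apply filter_imp. intros w Hw. symmetry. exact Hw.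
      - replace (F 0%C) with (1 * F 0 + 0 * C_derive F 0)%C by ring.
        apply (cderiv_mult (fun w => w) F); [apply cderiv_id|].
        apply (smooth_cderiv _ _ _ HF). }
    assert (HF0 := cont_neq0 _ _ (smooth_cont _ _ _ HF)).
    rewrite F1 in HF0. specialize (HF0 C1_nz).
    split.
    + apply smooth_ext with (fun w => C_derive f w * / F w)%C.
      * generalize (filter_and _ _ HF0 HfF). apply filter_imp. intros w [W1 W2].
        destruct (Ceq_dec w 0%C) as [->|W].
        { rewrite zf'_over_f_0, F1, Hf1. field. }
        { rewrite zf'_over_f_neq0, W2 by exact W. field. auto. }
      * apply smooth_mult; [apply smooth_derive; apply Sf|].
        apply smooth_inv; [rewrite F1; apply C1_nz|].
        apply smooth_pred, smooth_pred. exact HF.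
    + generalize (filter_and _ _ HF0 HfF). apply filter_imp. intros w [W1 W2] W.
      rewrite W2. apply Cmult_neq_0; assumption.
  - assert (N1 := cont_neq0 (fun w => w) z (continuous_id _) N).
    assert (N2 := cont_neq0 f z (smooth_cont _ _ _ (Sf 1%nat)) (Hfz N)).
    split.
    + apply smooth_ext with (fun w => w * C_derive f w * / f w)%C.
      * revert N1. apply filter_imp. intros w W. symmetry.
        apply (zf'_over_f_neq0 f w W).
      * apply smooth_mult; [apply smooth_mult|].
        { apply smooth_id. }
        { apply smooth_derive, Sf. }
        { apply smooth_inv; [exact (Hfz N)|apply Sf]. }
    + revert N2. apply filter_imp. intros w W _. exact W.
Qed.

(** After taking logarithms and dividing by beta, the exponent of x is alpha/beta = 1/mu - 1. *)
Lemma rpow_bound (alpha beta x y : R) :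
  0 <= alpha -> 0 < beta -> 0 < x -> 0 <= y ->
  let mu := beta / (alpha + beta) in
  rpow x alpha * rpow y beta < rpow (1 / 2 * mu) beta ->
  1 / mu * / x * Rpower x (1 / mu) * y < 1 / 2.
Proof.
  intros Ha Hb Hx Hy mu H.
  assert (Hmu : 0 < mu) by (apply Rdiv_lt_0_compat; lra).
  (* The case y = 0 is settled before logarithms appear, because [ln 0] is a default value. *)
  destruct (Req_dec y 0) as [->|N]; [lra|].
  unfold rpow in H.
  destruct (Req_EM_T x 0); [lra|]. destruct (Req_EM_T y 0); [lra|].
  destruct (Req_EM_T (1 / 2 * mu) 0); [lra|].
  unfold Rpower in H. rewrite <- exp_plus in H. apply exp_lt_inv in H.
  apply Rmult_lt_reg_l with mu; [exact Hmu|].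
  replace (mu * (1 / mu * / x * Rpower x (1 / mu) * y)) with
    (exp (- ln x + 1 / mu * ln x + ln y)).
  - replace (mu * (1 / 2)) with (exp (ln (1 / 2 * mu))) by (rewrite exp_ln; lra).
    apply exp_increasing. apply Rmult_lt_reg_l with beta; [exact Hb|].
    replace (beta * (- ln x + 1 / mu * ln x + ln y)) with (alpha * ln x + beta * ln y).
    + exact H.
    + unfold mu. field. lra.
  - rewrite !exp_plus, exp_Ropp, !exp_ln by lra. unfold Rpower. field. lra.
Qed.

(** The last hypothesis bounds |z q'|, with q' expanded by the chain rule. The maximum principle is
    used on the circle through [z] itself, so the bound 1/(2r) meets a segment of length exactly
    r. *)
Lemma Cpower_near_1 (f : C -> C) (k r0 : R) :
  class_A f -> r0 <= 1 ->
  (forall z, Cmod z < r0 -> (z <> 0%C -> f z <> 0%C) /\ 0 < Re (zf'_over_f f z)) ->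
  (forall z, Cmod z < r0 -> Cmod z * Cmod (RtoC k * / zf'_over_f f z *
     Cpower (zf'_over_f f z) (RtoC k) * C_derive (zf'_over_f f) z)%C <= 1 / 2) ->
  forall z, Cmod z < r0 -> Cmod (Cpower (zf'_over_f f z) (RtoC k) - 1)%C <= 1 / 2.
Proof.
  intros Hf Hr0 Hg Hb z Hz.
  set (p := zf'_over_f f) in *.
  set (q := fun w => Cpower (p w) (RtoC k)).
  assert (Sp : forall w n, Cmod w < r0 -> smooth n p w).
  { intros w n Hw. apply zf'_over_f_smooth; [exact Hf| |apply Hg; exact Hw].
    unfold unit_disk. lra. }
  assert (Sq : forall w n, Cmod w < r0 -> smooth n q w).
  { intros w n Hw. apply smooth_Cpower; [apply Hg; exact Hw|apply Sp; exact Hw]. }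
  assert (q0 : q 0%C = 1%C).
  { unfold q, p. rewrite zf'_over_f_0. apply Cpower_1. }
  destruct (Ceq_dec z 0%C) as [->|N].
  { fold (q (RtoC 0)). rewrite q0. replace (1 - 1)%C with (RtoC 0) by ring.
    rewrite Cmod_0. lra. }
  assert (Hz0 := proj1 (Cmod_gt_0 z) N). set (r := Cmod z) in *.
  assert (Hq : forall w, Cmod w <= r -> Cmod (C_derive q w) <= 1 / 2 / r).
  { apply max_modulus; [exact Hz0| |].
    - intros w Hw. apply smooth_derive. apply Sq. lra.
    - intros w Hw. assert (Hw' : Cmod w < r0) by lra.
      specialize (Hb w Hw'). rewrite Hw in Hb.
      replace (C_derive q w) with (k * / p w * q w * C_derive p w)%C.
      2:{ symmetry. apply cderiv_unique. apply cderiv_Cpower_comp.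
          - apply (Hg w Hw').
          - apply (smooth_cderiv 0). apply Sp. exact Hw'. }
      apply Rmult_le_reg_l with r; [exact Hz0|].
      replace (r * (1 / 2 / r)) with (1 / 2) by (field; lra). exact Hb. }
  assert (M := mean_value_Cmod q (C_derive q) 0%C z (1 / 2 / r)).
  replace (0 + z)%C with z in M by ring. rewrite q0 in M. fold r in M.
  replace (1 / 2 / r * r) with (1 / 2) in M by (field; lra). apply M.
  intros t Ht. replace (0 + t * z)%C with (t * z)%C by ring.
  assert (Ht' : Cmod (t * z)%C <= r).
  { rewrite Cmod_mult, Cmod_R, Rabs_pos_eq by lra. fold r. nra. }
  split; [|apply Hq; exact Ht'].
  apply (smooth_cderiv 0). apply Sq. lra.
Qed.

(* A Gronwall argument: [|f|^2 exp (6 t)] is nondecreasing along the outer half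
   of the segment from 0 to z. *)
Lemma bounded_log_derivative_neq0 (f : C -> C) (z : C) :
  (forall t, 0 < t <= 1 -> smooth 1 f (t * z)%C) ->
  f ((1 / 2)%R * z)%C <> 0%C ->
  (forall t, 0 < t < 1 ->
    Cmod (t * z * C_derive f (t * z))%C <= 3 / 2 * Cmod (f (t * z)%C)) ->
  f z <> 0%C.
Proof.
  intros Hs H2 Hb H0.
  (* [A] and [B] are the real and imaginary parts of f along the segment, in the shape that
     [line_derive] accepts. *)
  set (A := fun s : R => Re (1 * f (0 + s * z)%C)%C).
  set (B := fun s : R => Re (- Ci * f (0 + s * z)%C)%C).
  set (l := fun s : R => C_derive f (0 + s * z)%C).
  assert (E0 : forall s : R, (0 + s * z)%C = (s * z)%C) by (intros; ring).
  assert (DA : forall s, 0 < s <= 1 -> is_derive A s (Re (1 * (l s * z))%C)).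
  { intros s Hs1. apply line_derive. unfold l. rewrite E0.
    apply (smooth_cderiv 0). apply Hs. exact Hs1. }
  assert (DB : forall s, 0 < s <= 1 -> is_derive B s (Re (- Ci * (l s * z))%C)).
  { intros s Hs1. apply line_derive. unfold l. rewrite E0.
    apply (smooth_cderiv 0). apply Hs. exact Hs1. }
  (* For s >= 1/2 the bound 3/2 on |s z f'| / |f| becomes |z f'| <= 3 |f|, so |f|^2 decreases at
     relative rate at most 6. *)
  set (psi := fun s => (A s * A s + B s * B s) * exp (6 * s)).
  assert (AB : forall s, A s * A s + B s * B s = Cmod (f (s * z)%C) ^ 2).
  { intros s. unfold A, B. rewrite E0, Cmod2_alt. unfold Re, Im. simpl. ring. }
  set (dpsi := fun s => (2 * (A s * Re (1 * (l s * z))%C + B s * Re (- Ci * (l s * z))%C)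
    + 6 * (A s * A s + B s * B s)) * exp (6 * s)).
  assert (Dpsi : forall s, 0 < s <= 1 -> is_derive psi s (dpsi s)).
  { intros s Hs1. specialize (DA s Hs1). specialize (DB s Hs1). unfold psi, dpsi.
    auto_derive.
    - repeat split; eexists; eassumption.
    - change (fun x => A x) with A. change (fun x => B x) with B.
      rewrite (is_derive_unique A _ _ DA), (is_derive_unique B _ _ DB).
      ring. }
  destruct (MVT_gen psi (1 / 2) 1 dpsi) as [s [Hs1 E]].
  - intros s Hs1. rewrite Rmin_left, Rmax_right in Hs1 by lra. apply Dpsi. lra.
  - intros s Hs1. rewrite Rmin_left, Rmax_right in Hs1 by lra.
    apply continuity_pt_filterlim. apply (ex_derive_continuous (V := R_NormedModule)).
    exists (dpsi s). apply Dpsi. lra.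
  - rewrite Rmin_left, Rmax_right in Hs1 by lra.
    assert (P1 : psi 1 = 0).
    { unfold psi. rewrite AB. replace (1%R * z)%C with z by ring. rewrite H0, Cmod_0. ring. }
    assert (P2 : 0 < psi (1 / 2)).
    { unfold psi. rewrite AB. apply Rmult_lt_0_compat; [|apply exp_pos].
      apply pow_lt. apply Cmod_gt_0. exact H2. }
    assert (P3 : 0 <= dpsi s).
    { unfold dpsi. apply Rmult_le_pos; [|left; apply exp_pos].
      rewrite AB.
      replace (A s * Re (1 * (l s * z))%C + B s * Re (- Ci * (l s * z))%C) with
        (Re (Cconj (f (s * z)%C) * (l s * z))%C)
        by (unfold A, B; rewrite E0; unfold Re; simpl; ring).
      assert (R1 := re_mult_le (Cconj (f (s * z)%C)) (l s * z)%C).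
      rewrite Cmod_conj in R1. apply Rabs_le_between in R1.
      set (m := Cmod (f (s * z)%C)) in *.
      assert (Hm : 0 <= m) by apply Cmod_ge_0.
      (* The mean value point may be the endpoint, where the growth bound is not assumed; there f
         vanishes and so does the derivative. *)
      destruct (Req_dec s 1) as [->|Ns].
      { assert (m = 0).
        { unfold m. replace (1%R * z)%C with z by ring. rewrite H0. apply Cmod_0. }
        nra. }
      assert (R2 := Hb s ltac:(lra)). fold m in R2.
      replace (s * z * C_derive f (s * z))%C with (s * (l s * z))%C in R2
        by (unfold l; rewrite E0; ring).
      rewrite Cmod_mult, Cmod_R, Rabs_pos_eq in R2 by lra.
      assert (R3 : Cmod (l s * z)%C <= 3 * m).
      { assert (R4 := Cmod_ge_0 (l s * z)%C). nra. }
      nra. }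
    assert (0 <= dpsi s * (1 - 1 / 2)) by (apply Rmult_le_pos; lra). lra.
Qed.

(** * The sector condition and its limits along segments *)

Lemma segment_limit_ge (u : C -> R) (z : C) (m : R) :
  @continuous CK R_UniformSpace u z ->
  (forall t, 0 < t < 1 -> m <= u (t * z)%C) -> m <= u z.
Proof.
  intros Hu H. apply Rnot_lt_le. intros Hlt.
  assert (He : 0 < m - u z) by lra.
  assert (N := proj1 (filterlim_locally _ _) Hu (mkposreal _ He)).
  apply near_iff in N. destruct N as [d [Hd N]].
  assert (H0 := Cmod_ge_0 z).
  set (s := Rmin (1 / 2) (d / (2 * (Cmod z + 1)))).
  assert (Hs : 0 < s) by (apply Rmin_glb_lt; [lra|apply Rdiv_lt_0_compat; lra]).
  assert (Hs1 : s <= 1 / 2) by apply Rmin_l.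
  assert (Hs2 : s * (Cmod z + 1) <= d / 2).
  { replace (d / 2) with (d / (2 * (Cmod z + 1)) * (Cmod z + 1)) by (field; lra).
    apply Rmult_le_compat_r; [lra|apply Rmin_r]. }
  specialize (H (1 - s) ltac:(lra)). specialize (N ((1 - s)%R * z)%C).
  replace ((1 - s)%R * z - z)%C with (- (s * z))%C in N
    by (rewrite RtoC_minus; ring).
  rewrite Cmod_opp, Cmod_mult, Cmod_R, Rabs_pos_eq in N by lra.
  specialize (N ltac:(nra)).
  change (Rabs (u ((1 - s)%R * z)%C - u z) < m - u z) in N.
  apply Rabs_lt_between in N. lra.
Qed.

Lemma Rpower_ge_id (x k : R) : 1 <= x -> 1 <= k -> x <= Rpower x k.
Proof.
  intros Hx Hk. rewrite <- (Rpower_1 x) at 1 by lra. apply Rle_Rpower; lra.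
Qed.

Lemma Rpower_le_id (x k : R) : 0 < x <= 1 -> 1 <= k -> Rpower x k <= x.
Proof.
  intros Hx Hk. rewrite <- (exp_ln x) at 2 by lra. unfold Rpower.
  assert (L : ln x <= 0) by (rewrite <- ln_1; apply ln_le; lra).
  destruct (Rle_lt_or_eq_dec (k * ln x) (ln x)) as [H|H]; [nra| |].
  - left. apply exp_increasing. exact H.
  - rewrite H. lra.
Qed.

Lemma cos_le_cos_scale (x k : R) : 1 <= k -> Rabs (k * x) < PI / 2 -> cos (k * x) <= cos x.
Proof.
  intros Hk Hx. apply Rabs_lt_between in Hx. assert (P := PI_RGT_0).
  destruct (Rle_dec 0 x) as [L|L].
  - apply cos_decr_1; nra.
  - rewrite <- (cos_neg (k * x)), <- (cos_neg x). apply cos_decr_1; nra.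
Qed.

(** From |q| <= 3/2 and Re q >= 1/2 comes cos(arg q) >= 1/3. Since k >= 1, taking the root keeps |w|
    in [1/2, 3/2] and only reduces the argument, so Re w >= 1/2 * 1/3. *)
Lemma Cpower_near_1_bounds (w : C) (k : R) :
  1 <= k -> 0 < Re w -> Rabs (k * Carg w) < PI / 2 ->
  Cmod (Cpower w (RtoC k) - 1)%C <= 1 / 2 ->
  Cmod w <= 3 / 2 /\ 1 / 6 <= Re w /\ 1 / 3 <= cos (k * Carg w).
Proof.
  intros Hk Hw Ha H.
  assert (H0 := proj1 (Cmod_gt_0 _) (re_pos_neq0 w Hw)).
  destruct (Cpower_real w k Hw) as [E1 E2].
  set (q := Cpower w (RtoC k)) in *. set (X := Rpower (Cmod w) k) in *.
  set (th := k * Carg w) in *.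
  assert (U : X <= 3 / 2).
  { rewrite <- E1. replace q with ((q - 1) + 1)%C by ring.
    eapply Rle_trans; [apply Cmod_triangle|]. rewrite Cmod_1. lra. }
  assert (L : 1 / 2 <= X * cos th).
  { rewrite <- E2. assert (A := Rle_trans _ _ _ (re_le_Cmod (q - 1)%C) H).
    apply Rabs_le_between in A.
    replace (Re (q - 1)%C) with (Re q - 1) in A by reflexivity. lra. }
  assert (HX : 0 < X) by apply exp_pos.
  assert (C1 : 1 / 3 <= cos th) by nra.
  assert (C2 := COS_bound th).
  assert (C3 := cos_le_cos_scale (Carg w) k Hk Ha). fold th in C3.
  assert (X2 : 1 / 2 <= X) by nra.
  assert (W1 : Cmod w <= 3 / 2).
  { destruct (Rle_dec (Cmod w) (3 / 2)) as [|N]; [assumption|].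
    assert (A := Rpower_ge_id (Cmod w) k ltac:(lra) Hk). fold X in A. lra. }
  assert (W2 : 1 / 2 <= Cmod w).
  { destruct (Rle_dec (1 / 2) (Cmod w)) as [|N]; [assumption|].
    assert (A := Rpower_le_id (Cmod w) k ltac:(lra) Hk). fold X in A. lra. }
  split; [exact W1|]. split; [|exact C1].
  assert (E3 : Re w = Cmod w * cos (Carg w)).
  { rewrite <- (Cexp_Clog w Hw) at 1. unfold Cexp, Clog, Re, Im. simpl.
    rewrite exp_ln by exact H0. reflexivity. }
  rewrite E3. nra.
Qed.

(** Nonvanishing is listed separately because division is total: at a zero of f the quotient still
    has a value. The positive real part keeps the functional where [Clog] is differentiable. *)
Definition sector_at (f : C -> C) (k : R) (z : C) : Prop :=
  (z <> 0%C -> f z <> 0%C) /\ 0 < Re (zf'_over_f f z) /\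
  Rabs (k * Carg (zf'_over_f f z)) < PI / 2.

Lemma continuous_Carg_comp (p : C -> C) (z : C) (k : R) :
  cont p z -> 0 < Re (p z) ->
  @continuous CK R_UniformSpace (fun w => k * Carg (p w)) z.
Proof.
  intros Hp H.
  apply (continuous_scal_r (U := CK) (V := R_NormedModule) k (fun w => Carg (p w))).
  apply (continuous_comp (U := CK) (V := CK) (W := R_UniformSpace) p Carg); [exact Hp|].
  apply continuous_Carg. exact H.
Qed.

Lemma sector_at_open (f : C -> C) (k : R) (z : C) :
  class_A f -> unit_disk z -> sector_at f k z -> near z (sector_at f k).
Proof.
  intros Hf Hz [H1 [H2 H3]].
  destruct (zf'_over_f_smooth f z 1 Hf Hz H1) as [Sp N1].
  assert (Cp := smooth_cont _ _ _ Sp).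
  assert (N2 := near_re_pos _ _ Cp H2).
  assert (He : 0 < PI / 2 - Rabs (k * Carg (zf'_over_f f z))) by lra.
  assert (N3 := proj1 (filterlim_locally _ _)
    (continuous_Carg_comp _ z k Cp H2) (mkposreal _ He)).
  generalize (filter_and _ _ N1 (filter_and _ _ N2 N3)). apply filter_imp.
  intros w [W1 [W2 W3]]. split; [exact W1|]. split; [exact W2|].
  change (Rabs (k * Carg (zf'_over_f f w) - k * Carg (zf'_over_f f z)) <
    PI / 2 - Rabs (k * Carg (zf'_over_f f z))) in W3.
  assert (A := Rabs_triang_inv (k * Carg (zf'_over_f f w)) (k * Carg (zf'_over_f f z))).
  lra.
Qed.

Lemma sector_at_boundary (f : C -> C) (k : R) (z0 : C) :
  class_A f -> 1 <= k -> unit_disk z0 -> z0 <> 0%C ->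
  (forall z, Cmod z < Cmod z0 -> sector_at f k z) ->
  (forall z, Cmod z < Cmod z0 ->
     Cmod (Cpower (zf'_over_f f z) (RtoC k) - 1)%C <= 1 / 2) ->
  sector_at f k z0.
Proof.
  intros Hf Hk Hz0 N0 Hg Hq.
  assert (H0 := proj1 (Cmod_gt_0 _) N0).
  set (p := zf'_over_f f) in *.
  assert (Ht : forall t : R, 0 < t < 1 -> Cmod (t * z0)%C < Cmod z0).
  { intros t Ht. rewrite Cmod_mult, Cmod_R, Rabs_pos_eq by lra. nra. }
  assert (Hn : forall t : R, 0 < t -> (t * z0)%C <> 0%C).
  { intros t Ht1. apply Cmult_neq_0; [|exact N0]. intros E. apply RtoC_inj in E. lra. }
  assert (B : forall t : R, 0 < t < 1 -> Cmod (p (t * z0)%C) <= 3 / 2 /\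
    1 / 6 <= Re (p (t * z0)%C) /\ 1 / 3 <= cos (k * Carg (p (t * z0)%C))).
  { intros t Ht1. destruct (Hg _ (Ht t Ht1)) as [G1 [G2 G3]].
    apply Cpower_near_1_bounds; try assumption. apply Hq, Ht, Ht1. }
  (* This comes before any limit of [p] at [z0], since the continuity of [p] there depends on it. *)
  assert (F0 : f z0 <> 0%C).
  { apply bounded_log_derivative_neq0.
    - intros t Ht1. apply analytic_smooth. apply (proj1 Hf). unfold unit_disk in *.
      rewrite Cmod_mult, Cmod_R, Rabs_pos_eq by lra. nra.
    - apply (Hg ((1 / 2)%R * z0)%C); [apply Ht; lra|apply Hn; lra].
    - intros t Ht1. destruct (B t Ht1) as [B1 _].
      assert (Nt := Hn t ltac:(lra)).
      assert (Nf := proj1 (Hg _ (Ht t Ht1)) Nt).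
      unfold p in B1. rewrite zf'_over_f_neq0 in B1 by exact Nt.
      rewrite Cmod_div in B1 by exact Nf.
      apply Cmod_gt_0 in Nf.
      apply Rmult_le_compat_r with (r := Cmod (f (t * z0)%C)) in B1; [|lra].
      unfold Rdiv at 1 in B1. rewrite Rmult_assoc, Rinv_l, Rmult_1_r in B1 by lra.
      exact B1. }
  destruct (zf'_over_f_smooth f z0 1 Hf Hz0 (fun _ => F0)) as [Sp _]. fold p in Sp.
  assert (Cp := smooth_cont _ _ _ Sp).
  assert (R0 : 1 / 6 <= Re (p z0)).
  { apply (segment_limit_ge (fun w => Re (p w))); [|intros t Ht1; apply (B t Ht1)].
    apply (continuous_comp (U := CK) (V := CK) (W := R_UniformSpace) p Re); [exact Cp|].
    apply continuous_re. }
  assert (Ca := fun j => continuous_Carg_comp p z0 j Cp ltac:(lra)).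
  (* Only weak inequalities survive the limit; both sides come from lower bounds, for [k] and
     [- k]. *)
  assert (A1 : - (PI / 2) <= k * Carg (p z0)).
  { apply (segment_limit_ge (fun w => k * Carg (p w))); [apply Ca|].
    intros t Ht1. destruct (Hg _ (Ht t Ht1)) as [_ [_ G]].
    apply Rabs_lt_between in G. fold p in G. lra. }
  assert (A2 : - (PI / 2) <= (- k) * Carg (p z0)).
  { apply (segment_limit_ge (fun w => (- k) * Carg (p w))); [apply Ca|].
    intros t Ht1. destruct (Hg _ (Ht t Ht1)) as [_ [_ G]].
    apply Rabs_lt_between in G. fold p in G. lra. }
  (* This excludes equality, as the cosine vanishes at both ends of the interval. *)
  assert (A3 : 1 / 3 <= cos (k * Carg (p z0))).
  { apply (segment_limit_ge (fun w => cos (k * Carg (p w))));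
      [|intros t Ht1; apply (B t Ht1)].
    apply (continuous_comp (U := CK) (V := R_UniformSpace) (W := R_UniformSpace)
      (fun w => k * Carg (p w)) cos); [apply Ca|].
    apply (ex_derive_continuous (V := R_NormedModule)). eexists. apply is_derive_cos. }
  split; [intros _; exact F0|]. fold p. split; [lra|].
  apply Rabs_lt_between. assert (P := cos_PI2). split.
  - destruct (Rle_lt_or_eq_dec _ _ A1) as [|E]; [assumption|].
    rewrite <- E, cos_neg in A3. lra.
  - destruct (Rle_lt_or_eq_dec (k * Carg (p z0)) (PI / 2)) as [|E]; [lra|assumption|].
    rewrite E in A3. lra.
Qed.

Lemma sector_at_0 (f : C -> C) (k : R) : sector_at f k 0%C.
Proof.
  split; [easy|]. rewrite zf'_over_f_0. split; [simpl; lra|].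
  rewrite Carg_1, Rmult_0_r, Rabs_R0. assert (P := PI_RGT_0). lra.
Qed.

Theorem theorem4 (f : C -> C) (alpha beta : R)
    (hf : class_A f) (halpha : 0 <= alpha) (hbeta : 0 < beta) :
  let mu := beta / (alpha + beta) in
  (forall z : C, unit_disk z ->
     rpow (Cmod (zf'_over_f f z)) alpha *
     rpow (Cmod (z * C_derive (zf'_over_f f) z)%C) beta
       < rpow (1 / 2 * mu) beta) ->
  STS mu f.
Proof.
  intros mu H.
  assert (Hmu : 0 < mu) by (apply Rdiv_lt_0_compat; lra).
  set (k := 1 / mu).
  (* Indeed 1/mu = 1 + alpha/beta. *)
  assert (Hk : 1 <= k).
  { unfold k, mu. apply Rmult_le_reg_l with beta; [exact hbeta|].
    replace (beta * (1 / (beta / (alpha + beta)))) with (alpha + beta) by (field; lra).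
    lra. }
  assert (Hgood : forall z, unit_disk z -> sector_at f k z).
  { intros z1 Hz1. apply NNPP. intros Hbad. unfold unit_disk in Hz1.
    (* A failure of least modulus is a maximum of -|z| over the failures in the disk |z| <= |z1|, a
       closed set because the sector condition is open. *)
    destruct (compact_attains_max
      (fun z => Cmod z <= Cmod z1 /\ ~ sector_at f k z) (fun z => - Cmod z) (Cmod z1))
      as [z0 [[Hz0 B0] Hmin]].
    - intros z [Hz _]. exact Hz.
    - intros z Hz. destruct (Rle_dec (Cmod z) (Cmod z1)) as [L|L].
      + assert (G : sector_at f k z) by (apply NNPP; intros G; apply Hz; easy).
        assert (Hu : unit_disk z) by (unfold unit_disk; lra).
        generalize (sector_at_open f k z hf Hu G). apply filter_imp.
        intros w Hw [_ Hw2]. easy.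
      + assert (He : 0 < Cmod z - Cmod z1) by lra.
        assert (N := proj1 (filterlim_locally _ _) (continuous_Cmod z) (mkposreal _ He)).
        revert N. apply filter_imp. intros w Hw [Hw1 _].
        change (Rabs (Cmod w - Cmod z) < Cmod z - Cmod z1) in Hw.
        apply Rabs_lt_between in Hw. lra.
    - exists z1. split; [lra|exact Hbad].
    - intros z _ e He.
      assert (N := proj1 (filterlim_locally _ _) (continuous_Cmod z) (mkposreal _ He)).
      revert N. apply filter_imp. intros w Hw _.
      change (Rabs (Cmod w - Cmod z) < e) in Hw.
      apply Rabs_lt_between in Hw. lra.
    - assert (G : forall z, Cmod z < Cmod z0 -> sector_at f k z).
      { intros z Hz. apply NNPP. intros B. specialize (Hmin z ltac:(split; [lra|exact B])).
        lra. }
      apply B0. apply sector_at_boundary; try assumption.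
      + unfold unit_disk. lra.
      + intros E. apply B0. rewrite E. apply sector_at_0.
      + apply Cpower_near_1; [exact hf|lra| |].
        * intros z Hz. destruct (G z Hz) as [G1 [G2 _]]. easy.
        * intros z Hz. destruct (G z Hz) as [G1 [G2 _]].
          set (p := zf'_over_f f z) in *.
          assert (P0 := re_pos_neq0 p G2).
          assert (Hu : unit_disk z) by (unfold unit_disk; lra).
          assert (R := rpow_bound alpha beta _ _ halpha hbeta (proj1 (Cmod_gt_0 p) P0)
            (Cmod_ge_0 _) (H z Hu)).
          fold mu k in R.
          rewrite Cmod_mult in R. rewrite !Cmod_mult.
          rewrite Cmod_R, Rabs_pos_eq, Cmod_inv, (proj1 (Cpower_real p k G2)) by (try assumption; lra).
          nra. }
  split; [exact hf|]. intros z Hz. fold k.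
  destruct (Hgood z Hz) as [_ [G2 G3]].
  rewrite (proj2 (Cpower_real _ k G2)).
  apply Rmult_lt_0_compat; [apply exp_pos|].
  apply Rabs_lt_between in G3. apply cos_gt_0; lra.
Qed.
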